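(* Let $\Gamma=(\gamma_n)_{n\ge1}$ be a sequence of distinct complex numbers and $v=(v_n)$ a sequence of positive numbers such that $(\Gamma,v)^*\neq\emptyset$, and suppose that every exact uniqueness sequence for $H_{(\Gamma,v)}$ admits a generating function. Let $\Lambda=(\lambda_j)_{j\ge1}$ be a sequence of distinct points in $(\Gamma,v)^*$ and let $w$ be the Bessel weight sequence for $\Lambda$ with respect to $(\Gamma,v)$. Suppose $H_{(\Gamma,v);(\Lambda,w)}$ is bounded from $\ell^2_v$ to $\ell^2_w$. Then $H_{(\Gamma,v);(\Lambda,w)}$ is invertible (a bijection $\ell^2_v\to\ell^2_w$ with bounded inverse) if and only if $\Lambda$ is an exact uniqueness sequence for $H_{(\Gamma,v)}$ and the transformation $H_{(\Lambda,\varpi);(\Gamma,\nu)}$ is bounded from $\ell^2_\varpi$ to $\ell^2_\nu$ (in particular $\Gamma\subset(\Lambda,\varpi)^*$), where $\nu$ and $\varpi$ are defined as follows. Let $e=(e_n)\in\ell^2_v$ be the unique vector with $H_{(\Gamma,v)}e(\lambda_1)=1$ and $H_{(\Gamma,v)}e(\lambda_j)=0$ for $j\ge2$; set $\nu_n=v_n|\lambda_1-\gamma_n|^2|e_n|^2$, $\varpi_1=w_1^{-1}$ and, for $j\ge2$, \[ \varpi_j=w_j^{-1}|\lambda_j-\lambda_1|^{-2}\left|\sum_{n=1}^\infty\frac{e_nv_n}{(\lambda_j-\gamma_n)^2}\right|^{-2}. \]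
   Context: For a positive sequence $u$, $\ell^2_u=\{(a_k):\sum|a_k|^2u_k<\infty\}$. $(\Gamma,v)^*=\{z\in\mathbb{C}:\sum_n v_n/|z-\gamma_n|^2<\infty\}$, and for $a\in\ell^2_v$, $z\in(\Gamma,v)^*$, $H_{(\Gamma,v)}a(z)=\sum_na_nv_n/(z-\gamma_n)$. For a sequence $\Lambda=(\lambda_j)$ in $(\Gamma,v)^*$ and positive weights $w$, $H_{(\Gamma,v);(\Lambda,w)}a=(H_{(\Gamma,v)}a(\lambda_j))_j$; analogously, with roles exchanged, $H_{(\Lambda,\varpi);(\Gamma,\nu)}b=\left(\sum_j b_j\varpi_j/(\gamma_n-\lambda_j)\right)_n$ for $b\in\ell^2_\varpi$, which requires $\Gamma\subset(\Lambda,\varpi)^*=\{z:\sum_j\varpi_j/|z-\lambda_j|^2<\infty\}$. The Bessel weight sequence is $w_j=(\sum_n v_n/|\lambda_j-\gamma_n|^2)^{-1}$. A sequence $\Lambda$ of distinct points in $(\Gamma,v)^*$ is a uniqueness sequence for $H_{(\Gamma,v)}$ if no nonzero $a\in\ell^2_v$ has $H_{(\Gamma,v)}a$ vanishing on $\Lambda$; it is an exact uniqueness sequence if it is a uniqueness sequence but ceases to be one upon removal of any single point. For an exact uniqueness sequence $\Lambda$, a nontrivial function $G$ on $(\Gamma,v)^*$ is a generating function for $\Lambda$ if $G$ vanishes on $\Lambda$ and for every $\lambda_j\in\Lambda$ there is a nonzero $a^{(j)}\in\ell^2_v$ with $G(z)=(z-\lambda_j)H_{(\Gamma,v)}a^{(j)}(z)$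 for all $z\in(\Gamma,v)^*$. (When $\Lambda$ is an exact uniqueness sequence admitting a generating function, the vector $e$ exists uniquely and the series in $\varpi_j$ converges absolutely.) *)

(* Defs.v *)
From Stdlib Require Import Reals.
From Coquelicot Require Import Coquelicot.
Open Scope R_scope.

(* Sequences are indexed by nat, starting at 0 (the paper starts at 1). *)

Definition CSeries (a : nat -> C) : C :=
  (Series (fun n => Re (a n)), Series (fun n => Im (a n))).

Definition l2 (u : nat -> R) (a : nat -> C) : Prop :=
  ex_series (fun n => (Cmod (a n)) ^ 2 * u n).

Definition l2norm (u : nat -> R) (a : nat -> C) : R :=
  sqrt (Series (fun n => (Cmod (a n)) ^ 2 * u n)).

Definition dual (G : nat -> C) (v : nat -> R) (z : C) : Prop :=
  (forall n, z <> G n) /\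
  ex_series (fun n => v n / (Cmod (Cminus z (G n))) ^ 2).

Definition Hop (G : nat -> C) (v : nat -> R) (a : nat -> C) (z : C) : C :=
  CSeries (fun n => Cmult (Cmult (a n) (RtoC (v n))) (Cinv (Cminus z (G n)))).

Definition Hseq (G : nat -> C) (v : nat -> R) (L : nat -> C)
  (a : nat -> C) : nat -> C := fun j => Hop G v a (L j).

Definition bounded_map (u u' : nat -> R) (T : (nat -> C) -> (nat -> C)) : Prop :=
  exists M : R, forall a, l2 u a ->
    l2 u' (T a) /\ l2norm u' (T a) <= M * l2norm u a.

Definition invertible_map (u u' : nat -> R) (T : (nat -> C) -> (nat -> C)) : Prop :=
  (forall a, l2 u a -> l2 u' (T a)) /\
  exists S : (nat -> C) -> (nat -> C),
    (forall b, l2 u' b -> l2 u (S b)) /\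
    (forall a, l2 u a -> forall n, S (T a) n = a n) /\
    (forall b, l2 u' b -> forall j, T (S b) j = b j) /\
    (exists M : R, forall b, l2 u' b -> l2norm u (S b) <= M * l2norm u' b).

Definition uniqueness_seq (G : nat -> C) (v : nat -> R) (L : nat -> C) : Prop :=
  (forall j k, L j = L k -> j = k) /\
  (forall j, dual G v (L j)) /\
  (forall a, l2 v a -> (forall j, Hop G v a (L j) = RtoC 0) ->
     forall n, a n = RtoC 0).

Definition exact_uniqueness_seq (G : nat -> C) (v : nat -> R) (L : nat -> C) : Prop :=
  uniqueness_seq G v L /\
  (forall k, exists a, l2 v a /\ (exists n, a n <> RtoC 0) /\
     (forall j, j <> k -> Hop G v a (L j) = RtoC 0)).

Definition generating_function (G : nat -> C) (v : nat -> R) (L : nat -> C)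
  (F : C -> C) : Prop :=
  (exists z, dual G v z /\ F z <> RtoC 0) /\
  (forall j, F (L j) = RtoC 0) /\
  (forall j, exists a, l2 v a /\ (exists n, a n <> RtoC 0) /\
     forall z, dual G v z -> F z = Cmult (Cminus z (L j)) (Hop G v a z)).

Definition bessel_weight (G : nat -> C) (v : nat -> R) (L : nat -> C) (j : nat) : R :=
  / Series (fun n => v n / (Cmod (Cminus (L j) (G n))) ^ 2).

Definition nu (G : nat -> C) (v : nat -> R) (L : nat -> C) (e : nat -> C) (n : nat) : R :=
  v n * (Cmod (Cminus (L 0%nat) (G n))) ^ 2 * (Cmod (e n)) ^ 2.

Definition varpi (G : nat -> C) (v : nat -> R) (L : nat -> C) (e : nat -> C) (j : nat) : R :=
  match j with
  | O => / bessel_weight G v L 0%nat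
  | S _ => / bessel_weight G v L j * / (Cmod (Cminus (L j) (L 0%nat))) ^ 2 *
      / (Cmod (CSeries (fun n => Cmult (Cmult (e n) (RtoC (v n)))
                 (Cinv (Cmult (Cminus (L j) (G n)) (Cminus (L j) (G n))))))) ^ 2
  end.

(* Main.v *)
Require Import Defs.
From Stdlib Require Import Reals Lra Lia Classical.
From Coquelicot Require Import Coquelicot.
Open Scope R_scope.

(** The crux is that the system dual to an exact uniqueness sequence is Cauchy-like:
    with [e] dual to [L 0], the vector dual to [L k] is
    [kappa_k e_n (L 0 - G n) / (L k - G n)].  If [G] is not dense this follows by dividing
    by a linear factor vanishing off the closure of [G].  In general it follows from the
    identity, valid for a Lipschitz bump [h],
    [H b = H e * H (h a) - H a * H (h e)] with
    [b_n = sum_k v_k (a_n e_k - e_n a_k) (h_n - h_k) / (G n - G k)],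
    which puts [b] in the span of two dual vectors [e], [a]; letting [h] shrink to the
    indicator of one point [G m] gives the relation between coefficients.

    Consequently [varpi_k = |kappa_k|^2 / w_k], and up to diagonal unitary factors the
    transform from [L] to [G] is the synthesis map [b -> sum_j b_j x_j], [x_j] dual to
    [L j], that is, the inverse of the transform from [G] to [L]. *)

(** * Series *)

(** Both directions meet in one inequality, the Bessel bound nsq (sum_{j<N} b_j x_j) <= K sum_{j<N}
    |b_j|^2 w_j for finite combinations of the dual vectors. By biorthogonality the transform sends
    such a combination to a truncation of b, so a bounded inverse yields the bound; boundedness of
    the transform from [L] to [G], tested on truncated sequences, yields it too. Fatou extends it to
    infinite combinations. That these are preimages of b needs a limit argument, in which
    boundedness of the transform from [G] to [L] controls the tails.

    Square-summability of e_n (L 0 - G n) / (L k - G n) is not visible from the formula when [G]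
    accumulates at [L k]; it is inherited from the vector that exactness supplies, once the two are
    known to be proportional.

    The forward direction must also exclude e_n = 0: there nu_n vanishes, and a bound on the target
    norm says nothing about sum_j varpi_j / |G n - L j|^2. *)

Fixpoint psum (f : nat -> R) (N : nat) : R :=
  match N with O => 0 | S N => psum f N + f N end.

(** [sum_n] includes its upper index and [psum] excludes it; with the half-open convention heads,
    tails and truncations at the same N fit together without shifts. *)
Lemma sum_n_psum (f : nat -> R) (N : nat) : sum_n f N = psum f (S N).
Proof.
  induction N as [|N IH].
  - rewrite sum_O; simpl; ring.
  - rewrite sum_Sn, IH; simpl; unfold plus; simpl; ring.
Qed.

Lemma is_series_psum (f : nat -> R) (l : R) : is_series f l <-> is_lim_seq (psum f) l.
Proof.
  split; intro H.
  - apply is_lim_seq_incr_1.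
    apply is_lim_seq_ext with (sum_n f); [exact (sum_n_psum f) | exact H].
  - apply is_lim_seq_incr_1 in H.
    apply (is_lim_seq_ext _ (sum_n f)) in H;
      [exact H | intro n; symmetry; apply sum_n_psum].
Qed.

Lemma psum_lim (f : nat -> R) : ex_series f -> is_lim_seq (psum f) (Series f).
Proof. intro H; apply is_series_psum, Series_correct, H. Qed.

Lemma psum_ext (f g : nat -> R) (N : nat) :
  (forall n, (n < N)%nat -> f n = g n) -> psum f N = psum g N.
Proof.
  induction N as [|N IH]; intro H; simpl; [reflexivity|].
  rewrite IH by (intros; apply H; lia); rewrite H by lia; reflexivity.
Qed.

Lemma psum_le (f g : nat -> R) (N : nat) :
  (forall n, f n <= g n) -> psum f N <= psum g N.
Proof. intro H; induction N as [|N IH]; simpl; [lra|]; specialize (H N); lra. Qed.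

Lemma psum_pos (f : nat -> R) (N : nat) : (forall n, 0 <= f n) -> 0 <= psum f N.
Proof. intro H; induction N as [|N IH]; simpl; [lra|]; specialize (H N); lra. Qed.

Lemma psum_scal (c : R) (f : nat -> R) (N : nat) :
  psum (fun n => c * f n) N = c * psum f N.
Proof. induction N as [|N IH]; simpl; [ring|]; rewrite IH; ring. Qed.

Lemma ex_series_bounded (f : nat -> R) (M : R) :
  (forall n, 0 <= f n) -> (forall N, psum f N <= M) -> ex_series f /\ Series f <= M.
Proof.
  intros H HM.
  destruct (ex_finite_lim_seq_incr (psum f) M) as [l Hl].
  - intro n; simpl; specialize (H n); lra.
  - exact HM.
  - assert (Hs : is_series f l) by (apply is_series_psum, Hl).
    split; [exists l; exact Hs|].
    rewrite (is_series_unique _ _ Hs).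
    apply (is_lim_seq_le (psum f) (fun _ => M) l M HM Hl (is_lim_seq_const M)).
Qed.

Lemma psum_le_Series (f : nat -> R) (N : nat) :
  (forall n, 0 <= f n) -> ex_series f -> psum f N <= Series f.
Proof.
  intros H Hf.
  apply (is_lim_seq_incr_compare (psum f) (Series f) (psum_lim f Hf)).
  intro n; simpl; specialize (H n); lra.
Qed.

Lemma Series_pos (f : nat -> R) : (forall n, 0 <= f n) -> ex_series f -> 0 <= Series f.
Proof. intros H Hf; apply (psum_le_Series f 0 H Hf). Qed.

Lemma term_le_Series (f : nat -> R) (n : nat) :
  (forall n, 0 <= f n) -> ex_series f -> f n <= Series f.
Proof.
  intros H Hf.
  pose proof (psum_le_Series f (S n) H Hf) as H1; simpl in H1.
  pose proof (psum_pos f n H); lra.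
Qed.

Lemma ex_series_dom (f g : nat -> R) :
  (forall n, 0 <= f n <= g n) -> ex_series g -> ex_series f.
Proof.
  intros H Hg; apply (ex_series_le (K := R_AbsRing) (V := R_CompleteNormedModule)) with g;
    [|exact Hg].
  intro n; unfold norm; simpl; unfold abs; simpl.
  rewrite Rabs_right; [apply H | apply Rle_ge, H].
Qed.

Lemma ex_series_scal_R (c : R) (f : nat -> R) :
  ex_series f -> ex_series (fun n => c * f n).
Proof. intro H; apply (ex_series_scal_l c f H). Qed.

Lemma ex_series_plus_R (f g : nat -> R) :
  ex_series f -> ex_series g -> ex_series (fun n => f n + g n).
Proof. intros Hf Hg; exact (ex_series_plus f g Hf Hg). Qed.

Lemma ex_series_ext_R (f g : nat -> R) :
  (forall n, f n = g n) -> ex_series f -> ex_series g.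
Proof. intro H; apply ex_series_ext, H. Qed.

(** [z] is the filler beyond the cut; the type is a parameter so that the same cut serves real and
    complex sequences. *)
Definition trunc {A : Type} (z : A) (N : nat) (f : nat -> A) : nat -> A :=
  fun j => if Nat.ltb j N then f j else z.

Lemma psum_trunc (f : nat -> R) (N M : nat) :
  psum (trunc 0 N f) (N + M) = psum f N.
Proof.
  induction M as [|M IH].
  - rewrite Nat.add_0_r; apply psum_ext; intros n Hn; unfold trunc.
    replace (Nat.ltb n N) with true; [reflexivity|symmetry; apply Nat.ltb_lt, Hn].
  - rewrite Nat.add_succ_r; simpl; rewrite IH; unfold trunc.
    replace (Nat.ltb (N + M) N) with false; [ring|symmetry; apply Nat.ltb_ge; lia].
Qed.

Lemma is_series_trunc (f : nat -> R) (N : nat) : is_series (trunc 0 N f) (psum f N).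
Proof.
  apply is_series_psum, (is_lim_seq_incr_n _ N).
  apply is_lim_seq_ext with (fun _ => psum f N); [|apply is_lim_seq_const].
  intro n; rewrite Nat.add_comm, psum_trunc; reflexivity.
Qed.

Lemma Series_tail (f : nat -> R) (N : nat) :
  ex_series f -> ex_series (fun j => f j - trunc 0 N f j) /\
  Series (fun j => f j - trunc 0 N f j) = Series f - psum f N.
Proof.
  intro Hf.
  assert (Ht : ex_series (trunc 0 N f)) by (exists (psum f N); apply is_series_trunc).
  split; [exact (ex_series_minus _ _ Hf Ht)|].
  rewrite Series_minus by assumption.
  rewrite (is_series_unique _ _ (is_series_trunc f N)); reflexivity.
Qed.

Lemma psum_tail_lim (f : nat -> R) :
  ex_series f -> is_lim_seq (fun N => Series f - psum f N) 0.
Proof.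
  intro Hf.
  replace (Finite 0) with (Finite (Series f - Series f)) by (f_equal; ring).
  apply is_lim_seq_minus'; [apply is_lim_seq_const | apply psum_lim, Hf].
Qed.

Lemma psum_lim_pointwise (f : nat -> nat -> R) (l : nat -> R) (N : nat) :
  (forall k, is_lim_seq (fun s => f s k) (l k)) ->
  is_lim_seq (fun s => psum (f s) N) (psum l N).
Proof.
  intro H; induction N as [|N IH]; simpl; [apply is_lim_seq_const|].
  apply is_lim_seq_plus'; [exact IH | apply H].
Qed.

(** Dominated convergence: past some K the tail of [B] is small for all s at once, and the K
    remaining terms form a finite sum tending to 0. *)
Lemma dominated_series_0 (f : nat -> nat -> R) (B : nat -> R) :
  (forall s k, 0 <= f s k <= B k) -> ex_series B ->
  (forall k, is_lim_seq (fun s => f s k) 0) ->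
  is_lim_seq (fun s => Series (f s)) 0.
Proof.
  intros Hf HB Hl.
  assert (HB0 : forall k, 0 <= B k) by (intro k; specialize (Hf 0%nat k); lra).
  assert (Hex : forall s, ex_series (f s)) by (intro s; apply ex_series_dom with B; auto).
  apply is_lim_seq_spec; intros [eps Heps]; simpl.
  pose proof (psum_tail_lim B HB) as HT; apply is_lim_seq_spec in HT.
  assert (He2 : 0 < eps / 2) by lra.
  destruct (HT (mkposreal _ He2)) as [K HK]; specialize (HK K (Nat.le_refl K)); simpl in HK.
  pose proof (psum_lim_pointwise f (fun _ => 0) K Hl) as HP.
  replace (psum (fun _ => 0) K) with 0 in HP by (clear; induction K; simpl; lra).
  apply is_lim_seq_spec in HP.
  destruct (HP (mkposreal _ He2)) as [s0 Hs0]; simpl in Hs0.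
  exists s0; intros s Hs; specialize (Hs0 s Hs).
  destruct (Series_tail (f s) K (Hex s)) as [E1 E2].
  destruct (Series_tail B K HB) as [E3 E4].
  assert (Series (fun j => f s j - trunc 0 K (f s) j)
          <= Series (fun j => B j - trunc 0 K B j)).
  { apply Series_le; [|exact E3].
    intro n; unfold trunc; specialize (Hf s n).
    destruct (Nat.ltb n K); lra. }
  pose proof (Series_pos (f s) (fun k => proj1 (Hf s k)) (Hex s)).
  apply Rabs_def2 in HK; apply Rabs_def2 in Hs0.
  apply Rabs_def1; lra.
Qed.

(** * Complex series: absolute summability, limits, dominated convergence, Fubini *)

Fixpoint cpsum (f : nat -> C) (N : nat) : C :=
  match N with O => RtoC 0 | S N => Cplus (cpsum f N) (f N) end.

Definition summable (f : nat -> C) : Prop := ex_series (fun n => Cmod (f n)).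

Definition Clim (u : nat -> C) (l : C) : Prop :=
  is_lim_seq (fun n => Cmod (u n - l)%C) 0.

Lemma Cmod_minus_sym (x y : C) : Cmod (x - y)%C = Cmod (y - x)%C.
Proof. rewrite <- Cmod_opp; f_equal; ring. Qed.

Lemma Cmod_minus_triangle (x y : C) : Cmod (x - y)%C <= Cmod x + Cmod y.
Proof. unfold Cminus; rewrite <- (Cmod_opp y); apply Cmod_triangle. Qed.

Lemma im_le_Cmod (z : C) : Rabs (Im z) <= Cmod z.
Proof. apply Rle_trans with (2 := Rmax_Cmod z), Rmax_r. Qed.

Lemma summable_Re (f : nat -> C) : summable f -> ex_series (fun n => Re (f n)).
Proof.
  intro H; apply ex_series_Rabs, ex_series_dom with (2 := H).
  intro n; split; [apply Rabs_pos | apply re_le_Cmod].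
Qed.

Lemma summable_Im (f : nat -> C) : summable f -> ex_series (fun n => Im (f n)).
Proof.
  intro H; apply ex_series_Rabs, ex_series_dom with (2 := H).
  intro n; split; [apply Rabs_pos | apply im_le_Cmod].
Qed.

Lemma summable_dom (f : nat -> C) (B : nat -> R) :
  (forall n, Cmod (f n) <= B n) -> ex_series B -> summable f.
Proof. intros H HB; apply ex_series_dom with (2 := HB); split; [apply Cmod_ge_0 | apply H]. Qed.

Lemma summable_ext (f g : nat -> C) : (forall n, f n = g n) -> summable f -> summable g.
Proof. intro H; apply ex_series_ext; intro n; rewrite H; reflexivity. Qed.

Lemma summable_plus (f g : nat -> C) :
  summable f -> summable g -> summable (fun n => f n + g n)%C.
Proof.
  intros Hf Hg; eapply summable_dom; [|exact (ex_series_plus_R _ _ Hf Hg)].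
  intro n; apply Cmod_triangle.
Qed.

Lemma summable_minus (f g : nat -> C) :
  summable f -> summable g -> summable (fun n => f n - g n)%C.
Proof.
  intros Hf Hg; eapply summable_dom; [|exact (ex_series_plus_R _ _ Hf Hg)].
  intro n; apply Cmod_minus_triangle.
Qed.

Lemma summable_scal (c : C) (f : nat -> C) : summable f -> summable (fun n => c * f n)%C.
Proof.
  intro Hf; eapply summable_dom; [|exact (ex_series_scal_R (Cmod c) _ Hf)].
  intro n; rewrite Cmod_mult; apply Rle_refl.
Qed.

Lemma CSeries_ext (f g : nat -> C) : (forall n, f n = g n) -> CSeries f = CSeries g.
Proof.
  intro H; unfold CSeries; f_equal; apply Series_ext; intro n; rewrite H; reflexivity.
Qed.

Lemma CSeries_plus (f g : nat -> C) : summable f -> summable g ->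
  CSeries (fun n => f n + g n)%C = (CSeries f + CSeries g)%C.
Proof.
  intros Hf Hg; unfold CSeries, Cplus; simpl; f_equal.
  - rewrite <- Series_plus by (apply summable_Re; assumption); reflexivity.
  - rewrite <- Series_plus by (apply summable_Im; assumption); reflexivity.
Qed.

Lemma CSeries_scal (c : C) (f : nat -> C) : summable f ->
  CSeries (fun n => c * f n)%C = (c * CSeries f)%C.
Proof.
  intros Hf; unfold CSeries, Cmult; simpl.
  pose proof (summable_Re f Hf); pose proof (summable_Im f Hf).
  f_equal.
  - rewrite <- !Series_scal_l, <- Series_minus; [reflexivity| |]; apply ex_series_scal_R; assumption.
  - rewrite <- !Series_scal_l, <- Series_plus; [reflexivity| |]; apply ex_series_scal_R; assumption.
Qed.

Lemma CSeries_minus (f g : nat -> C) : summable f -> summable g ->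
  CSeries (fun n => f n - g n)%C = (CSeries f - CSeries g)%C.
Proof.
  intros Hf Hg.
  rewrite (CSeries_ext _ (fun n => f n + (RtoC (-1)) * g n)%C) by (intro n; ring).
  rewrite CSeries_plus, CSeries_scal; auto using summable_scal; ring.
Qed.

Lemma CSeries_0 : CSeries (fun _ => RtoC 0) = RtoC 0.
Proof.
  unfold CSeries, RtoC; simpl.
  assert (E : Series (fun _ => 0) = 0)
    by (rewrite (Series_ext _ (fun _ => 0 * 0)) by (intro; ring);
        rewrite Series_scal_l; ring).
  rewrite E; reflexivity.
Qed.

Lemma Cmod_le_Re_Im (z : C) : Cmod z <= Rabs (Re z) + Rabs (Im z).
Proof.
  replace z with (RtoC (Re z) + Ci * RtoC (Im z))%C at 1
    by (destruct z; unfold Cplus, Cmult, RtoC, Ci; simpl; f_equal; ring).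
  apply Rle_trans with (1 := Cmod_triangle _ _).
  rewrite Cmod_mult, Cmod_Ci, !Cmod_R; lra.
Qed.

Lemma Clim_le_0 (u : nat -> C) (l : C) (d : nat -> R) :
  (forall n, Cmod (u n - l)%C <= d n) -> is_lim_seq d 0 -> Clim u l.
Proof.
  intros H Hd; apply is_lim_seq_le_le with (fun _ => 0) d;
    [intro n; split; [apply Cmod_ge_0 | apply H] | apply is_lim_seq_const | exact Hd].
Qed.

Lemma Clim_unique (u : nat -> C) (l m : C) : Clim u l -> Clim u m -> l = m.
Proof.
  intros Hl Hm.
  assert (H : Cmod (l - m)%C <= 0).
  { apply (is_lim_seq_le (fun _ => Cmod (l - m)%C)
             (fun n => Cmod (u n - l)%C + Cmod (u n - m)%C) (Cmod (l - m)%C) 0).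
    - intro n; rewrite (Cmod_minus_sym (u n) l).
      replace (l - m)%C with ((l - u n) + (u n - m))%C by ring; apply Cmod_triangle.
    - apply is_lim_seq_const.
    - replace (Finite 0) with (Finite (0 + 0)) by (f_equal; ring).
      apply is_lim_seq_plus'; assumption. }
  pose proof (Cmod_ge_0 (l - m)%C).
  assert (E : (l - m)%C = RtoC 0) by (apply Cmod_eq_0; lra).
  replace l with ((l - m) + m)%C by ring; rewrite E; ring.
Qed.

Lemma Clim_ext (u u' : nat -> C) (l : C) : (forall n, u n = u' n) -> Clim u l -> Clim u' l.
Proof. intro H; apply is_lim_seq_ext; intro n; rewrite H; reflexivity. Qed.

Lemma Clim_minus (u u' : nat -> C) (l l' : C) :
  Clim u l -> Clim u' l' -> Clim (fun n => u n - u' n)%C (l - l')%C.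
Proof.
  intros H H'; apply Clim_le_0 with (fun n => Cmod (u n - l)%C + Cmod (u' n - l')%C).
  - intro n; replace (u n - u' n - (l - l'))%C with ((u n - l) - (u' n - l'))%C by ring.
    apply Cmod_minus_triangle.
  - replace (Finite 0) with (Finite (0 + 0)) by (f_equal; ring).
    apply is_lim_seq_plus'; assumption.
Qed.

Lemma Clim_scal (c : C) (u : nat -> C) (l : C) :
  Clim u l -> Clim (fun n => c * u n)%C (c * l)%C.
Proof.
  intro H; apply Clim_le_0 with (fun n => Cmod c * Cmod (u n - l)%C).
  - intro n; rewrite <- Cmod_mult; right; f_equal; ring.
  - replace (Finite 0) with (Rbar_mult (Cmod c) 0) by (simpl; f_equal; ring).
    apply is_lim_seq_scal_l, H.
Qed.

Lemma Clim_Cmod (u : nat -> C) (l : C) : Clim u l -> is_lim_seq (fun n => Cmod (u n)) (Cmod l).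
Proof.
  intro H; apply is_lim_seq_le_le with
    (fun n => Cmod l - Cmod (u n - l)%C) (fun n => Cmod l + Cmod (u n - l)%C).
  - intro n; split.
    + pose proof (Cmod_minus_triangle (u n) (u n - l)%C) as E.
      replace (u n - (u n - l))%C with l in E by ring; lra.
    + pose proof (Cmod_triangle l (u n - l)%C) as E.
      replace (l + (u n - l))%C with (u n) in E by ring; lra.
  - replace (Finite (Cmod l)) with (Finite (Cmod l - 0)) by (f_equal; ring).
    apply is_lim_seq_minus'; [apply is_lim_seq_const | exact H].
  - replace (Finite (Cmod l)) with (Finite (Cmod l + 0)) by (f_equal; ring).
    apply is_lim_seq_plus'; [apply is_lim_seq_const | exact H].
Qed.

Lemma cpsum_ext (f g : nat -> C) (N : nat) :
  (forall n, (n < N)%nat -> f n = g n) -> cpsum f N = cpsum g N.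
Proof.
  induction N as [|N IH]; intro H; simpl; [reflexivity|].
  rewrite IH by (intros; apply H; lia); rewrite H by lia; reflexivity.
Qed.

Lemma cpsum_scal (c : C) (f : nat -> C) (N : nat) :
  cpsum (fun n => c * f n)%C N = (c * cpsum f N)%C.
Proof. induction N as [|N IH]; simpl; [ring|]; rewrite IH; ring. Qed.

Lemma cpsum_Re_Im (f : nat -> C) (N : nat) :
  cpsum f N = (psum (fun n => Re (f n)) N, psum (fun n => Im (f n)) N).
Proof.
  induction N as [|N IH]; simpl; [reflexivity|].
  rewrite IH; unfold Cplus; simpl; reflexivity.
Qed.

Lemma Cmod_cpsum_le (f : nat -> C) (N : nat) :
  Cmod (cpsum f N) <= psum (fun n => Cmod (f n)) N.
Proof.
  induction N as [|N IH]; simpl; [rewrite Cmod_0; lra|].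
  apply Rle_trans with (1 := Cmod_triangle _ _); lra.
Qed.

Lemma cpsum_lim (f : nat -> C) : summable f -> Clim (cpsum f) (CSeries f).
Proof.
  intro H.
  apply Clim_le_0 with (fun N => Rabs (psum (fun n => Re (f n)) N - Series (fun n => Re (f n)))
    + Rabs (psum (fun n => Im (f n)) N - Series (fun n => Im (f n)))).
  - intro N; rewrite cpsum_Re_Im; apply Cmod_le_Re_Im.
  - replace (Finite 0) with (Finite (0 + 0)) by (f_equal; ring).
    apply is_lim_seq_plus'; rewrite <- Rabs_R0 at 1;
      apply (is_lim_seq_abs _ (Finite 0)).
    + replace (Finite 0) with (Finite (Series (fun n => Re (f n)) - Series (fun n => Re (f n))))
        by (f_equal; ring).
      apply is_lim_seq_minus'; [apply psum_lim, summable_Re, H | apply is_lim_seq_const].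
    + replace (Finite 0) with (Finite (Series (fun n => Im (f n)) - Series (fun n => Im (f n))))
        by (f_equal; ring).
      apply is_lim_seq_minus'; [apply psum_lim, summable_Im, H | apply is_lim_seq_const].
Qed.

Lemma Cmod_CSeries_le_Series (f : nat -> C) : summable f ->
  Cmod (CSeries f) <= Series (fun n => Cmod (f n)).
Proof.
  intro H.
  apply (is_lim_seq_le (fun N => Cmod (cpsum f N)) (fun N => psum (fun n => Cmod (f n)) N)
           (Cmod (CSeries f)) (Series (fun n => Cmod (f n)))).
  - intro N; apply Cmod_cpsum_le.
  - apply Clim_Cmod, cpsum_lim, H.
  - apply psum_lim, H.
Qed.

Lemma dominated_CSeries (f : nat -> nat -> C) (g : nat -> C) (B : nat -> R) :
  (forall s k, Cmod (f s k) <= B k) -> ex_series B ->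
  (forall k, Clim (fun s => f s k) (g k)) ->
  Clim (fun s => CSeries (f s)) (CSeries g).
Proof.
  intros Hf HB Hl.
  assert (Hg : forall k, Cmod (g k) <= B k).
  { intro k; apply (is_lim_seq_le (fun s => Cmod (f s k)) (fun _ => B k) (Cmod (g k)) (B k));
      [auto | apply Clim_Cmod, Hl | apply is_lim_seq_const]. }
  assert (Sf : forall s, summable (f s)) by (intro s; apply summable_dom with B; auto).
  assert (Sg : summable g) by (apply summable_dom with B; auto).
  apply Clim_le_0 with (fun s => Series (fun k => Cmod (f s k - g k)%C)).
  - intro s; rewrite <- CSeries_minus by auto.
    apply Cmod_CSeries_le_Series, summable_minus; auto.
  - apply (dominated_series_0 (fun s k => Cmod (f s k - g k)%C) (fun k => 2 * B k)).
    + intros s k; split; [apply Cmod_ge_0|].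
      apply Rle_trans with (1 := Cmod_minus_triangle _ _).
      specialize (Hf s k); specialize (Hg k); lra.
    + apply ex_series_scal_R, HB.
    + exact Hl.
Qed.

Lemma CSeries_cpsum (F : nat -> nat -> C) (N : nat) :
  (forall j, (j < N)%nat -> summable (F j)) ->
  summable (fun n => cpsum (fun j => F j n) N) /\
  CSeries (fun n => cpsum (fun j => F j n) N) = cpsum (fun j => CSeries (F j)) N.
Proof.
  induction N as [|N IH]; intro H; simpl.
  - split; [|apply CSeries_0].
    eapply summable_dom; [intro; rewrite Cmod_0; apply Rle_refl|].
    exists 0; apply is_series_psum; apply is_lim_seq_ext with (fun _ => 0);
      [|apply is_lim_seq_const].
    intro n; induction n as [|n IHn]; simpl; lra.
  - destruct IH as [S1 S2]; [intros; apply H; lia|].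
    assert (SN : summable (F N)) by (apply H; lia).
    split; [apply summable_plus; assumption|].
    rewrite CSeries_plus, S2 by assumption; reflexivity.
Qed.

(** For finitely many rows the exchange is linearity. The sums over the first N rows are dominated
    by [Series x * y k], so dominated convergence carries the exchange to the limit. *)
Lemma CSeries_Fubini (F : nat -> nat -> C) (x y : nat -> R) :
  (forall n k, Cmod (F n k) <= x n * y k) ->
  (forall n, 0 <= x n) -> (forall k, 0 <= y k) -> ex_series x -> ex_series y ->
  CSeries (fun n => CSeries (fun k => F n k)) = CSeries (fun k => CSeries (fun n => F n k)).
Proof.
  intros HF Hx Hy Sx Sy.
  assert (SF : forall n, summable (F n))
    by (intro n; apply summable_dom with (fun k => x n * y k); auto using ex_series_scal_R).
  assert (SF' : forall k, summable (fun n => F n k)).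
  { intro k; apply summable_dom with (fun n => y k * x n); [|auto using ex_series_scal_R].
    intro n; rewrite Rmult_comm; auto. }
  apply Clim_unique with (cpsum (fun n => CSeries (fun k => F n k))).
  - apply cpsum_lim, summable_dom with (fun n => Series y * x n);
      [|apply ex_series_scal_R, Sx].
    intro n; apply Rle_trans with (1 := Cmod_CSeries_le_Series _ (SF n)).
    apply Rle_trans with (Series (fun k => x n * y k)).
    + apply Series_le; [|apply ex_series_scal_R, Sy].
      intro k; split; [apply Cmod_ge_0 | auto].
    + rewrite Series_scal_l; lra.
  - apply Clim_ext with (fun N => CSeries (fun k => cpsum (fun n => F n k) N)).
    + intro N; apply CSeries_cpsum; auto.
    + apply dominated_CSeries with (fun k => Series x * y k).
      * intros N k; apply Rle_trans with (1 := Cmod_cpsum_le _ _).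
        apply Rle_trans with (psum (fun n => y k * x n) N).
        -- apply psum_le; intro n; rewrite Rmult_comm; auto.
        -- rewrite psum_scal, Rmult_comm; apply Rmult_le_compat_r; auto.
           apply psum_le_Series; auto.
      * apply ex_series_scal_R, Sy.
      * intro k; apply cpsum_lim, SF'.
Qed.

Lemma CSeries_trunc (f : nat -> C) (N : nat) :
  CSeries (trunc (RtoC 0) N f) = cpsum f N.
Proof.
  rewrite cpsum_Re_Im; unfold CSeries; f_equal; apply is_series_unique.
  - apply is_series_ext with (trunc 0 N (fun n => Re (f n))); [|apply is_series_trunc].
    intro n; unfold trunc; destruct (Nat.ltb n N); reflexivity.
  - apply is_series_ext with (trunc 0 N (fun n => Im (f n))); [|apply is_series_trunc].
    intro n; unfold trunc; destruct (Nat.ltb n N); reflexivity.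
Qed.

Lemma summable_trunc (f : nat -> C) (N : nat) : summable (trunc (RtoC 0) N f).
Proof.
  exists (psum (fun n => Cmod (f n)) N).
  apply is_series_ext with (trunc 0 N (fun n => Cmod (f n))); [|apply is_series_trunc].
  intro n; unfold trunc; destruct (Nat.ltb n N); [reflexivity | symmetry; apply Cmod_0].
Qed.

(** * Weighted l2 spaces and the discrete Hilbert transform *)

Lemma Cminus_neq_0 (x y : C) : x <> y -> (x - y)%C <> RtoC 0.
Proof.
  intros H E; apply H; replace x with ((x - y) + y)%C by ring; rewrite E; ring.
Qed.

Lemma Cmod_minus_pos (x y : C) : x <> y -> 0 < Cmod (x - y)%C.
Proof. intro H; apply Cmod_gt_0, Cminus_neq_0, H. Qed.

Lemma pow2_Cmod_pos (z : C) : 0 <= Cmod z ^ 2.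
Proof. apply pow2_ge_0. Qed.

(** Estimates are run on squared norms; square roots return only when a bound is stated through
    [l2norm]. *)
Definition nsq (u : nat -> R) (a : nat -> C) : R :=
  Series (fun n => Cmod (a n) ^ 2 * u n).

Section L2.
Variable u : nat -> R.
Hypothesis Hu : forall n, 0 <= u n.

Lemma l2_term_pos (a : nat -> C) (n : nat) : 0 <= Cmod (a n) ^ 2 * u n.
Proof. apply Rmult_le_pos; [apply pow2_Cmod_pos | apply Hu]. Qed.

Lemma nsq_pos (a : nat -> C) : l2 u a -> 0 <= nsq u a.
Proof. intro H; apply Series_pos; [apply l2_term_pos | exact H]. Qed.

Lemma term_le_nsq (a : nat -> C) (n : nat) : l2 u a -> Cmod (a n) ^ 2 * u n <= nsq u a.
Proof. intro H; apply (term_le_Series _ n (l2_term_pos a) H). Qed.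

Lemma nsq_ext (a b : nat -> C) : (forall n, a n = b n) -> nsq u a = nsq u b.
Proof. intro H; apply Series_ext; intro n; rewrite H; reflexivity. Qed.

Lemma l2_ext (a b : nat -> C) : (forall n, a n = b n) -> l2 u a -> l2 u b.
Proof. intro H; apply ex_series_ext; intro n; rewrite H; reflexivity. Qed.

Lemma l2_mult (a c : nat -> C) (K : R) :
  (forall n, Cmod (c n) <= K) -> l2 u a -> l2 u (fun n => c n * a n)%C.
Proof.
  intros Hc Ha; apply ex_series_dom with (fun n => K ^ 2 * (Cmod (a n) ^ 2 * u n)).
  - intro n; split; [apply (l2_term_pos (fun n => c n * a n)%C)|].
    rewrite Cmod_mult, Rpow_mult_distr, <- Rmult_assoc.
    apply Rmult_le_compat_r; [apply Hu|].
    apply Rmult_le_compat_r; [apply pow2_Cmod_pos|].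
    apply pow_incr; split; [apply Cmod_ge_0 | apply Hc].
  - apply ex_series_scal_R, Ha.
Qed.

Lemma l2_scal (c : C) (a : nat -> C) : l2 u a -> l2 u (fun n => c * a n)%C.
Proof. apply l2_mult with (K := Cmod c); intros; apply Rle_refl. Qed.

Lemma l2_plus (a b : nat -> C) : l2 u a -> l2 u b -> l2 u (fun n => a n + b n)%C.
Proof.
  intros Ha Hb.
  apply ex_series_dom with (fun n => 2 * (Cmod (a n) ^ 2 * u n + Cmod (b n) ^ 2 * u n)).
  - intro n; split; [apply (l2_term_pos (fun n => a n + b n)%C)|].
    rewrite <- Rmult_plus_distr_r, <- Rmult_assoc.
    apply Rmult_le_compat_r; [apply Hu|].
    pose proof (Cmod_triangle (a n) (b n)); pose proof (Cmod_ge_0 (a n + b n)%C).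
    pose proof (pow2_ge_0 (Cmod (a n) - Cmod (b n))).
    apply Rle_trans with ((Cmod (a n) + Cmod (b n)) ^ 2); [apply pow_incr; lra | nra].
  - apply ex_series_scal_R, ex_series_plus_R; assumption.
Qed.

Lemma l2_minus (a b : nat -> C) : l2 u a -> l2 u b -> l2 u (fun n => a n - b n)%C.
Proof.
  intros Ha Hb; apply l2_ext with (fun n => a n + RtoC (-1) * b n)%C; [intro; ring|].
  apply l2_plus; [exact Ha | apply l2_scal, Hb].
Qed.

Lemma l2_0 : l2 u (fun _ => RtoC 0).
Proof.
  apply ex_series_ext with (trunc 0 0 (fun _ : nat => 0)).
  - intro n; unfold trunc; simpl; rewrite Cmod_0; ring.
  - exists (psum (fun _ => 0) 0); apply is_series_trunc.
Qed.

Lemma l2_cpsum (x : nat -> nat -> C) (N : nat) :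
  (forall j, l2 u (x j)) -> l2 u (fun n => cpsum (fun j => x j n) N).
Proof.
  intro H; induction N as [|N IH]; simpl; [apply l2_0 | apply l2_plus; auto].
Qed.

Lemma trunc_sq (b : nat -> C) (N n : nat) :
  Cmod (trunc (RtoC 0) N b n) ^ 2 * u n = trunc 0 N (fun n => Cmod (b n) ^ 2 * u n) n.
Proof. unfold trunc; destruct (Nat.ltb n N); [reflexivity | rewrite Cmod_0; ring]. Qed.

Lemma l2_trunc (b : nat -> C) (N : nat) : l2 u (trunc (RtoC 0) N b).
Proof.
  apply ex_series_ext with (trunc 0 N (fun n => Cmod (b n) ^ 2 * u n)).
  - intro n; symmetry; apply trunc_sq.
  - eexists; apply is_series_trunc.
Qed.

Lemma nsq_trunc (b : nat -> C) (N : nat) :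
  nsq u (trunc (RtoC 0) N b) = psum (fun n => Cmod (b n) ^ 2 * u n) N.
Proof.
  apply is_series_unique.
  apply is_series_ext with (trunc 0 N (fun n => Cmod (b n) ^ 2 * u n));
    [intro n; symmetry; apply trunc_sq | apply is_series_trunc].
Qed.

Lemma nsq_tail (b : nat -> C) (N : nat) : l2 u b ->
  nsq u (fun n => b n - trunc (RtoC 0) N b n)%C
  = nsq u b - psum (fun n => Cmod (b n) ^ 2 * u n) N.
Proof.
  intro Hb; unfold nsq.
  rewrite <- (proj2 (Series_tail _ N Hb)); apply Series_ext; intro n; unfold trunc.
  destruct (Nat.ltb n N).
  - replace (b n - b n)%C with (RtoC 0) by ring; rewrite Cmod_0; ring.
  - replace (b n - RtoC 0)%C with (b n) by ring; ring.
Qed.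

End L2.

Lemma l2norm_le_sqrt (u u' : nat -> R) (a b : nat -> C) (K : R) :
  (forall n, 0 <= u n) -> 0 <= K -> l2 u a ->
  nsq u' b <= K * nsq u a -> l2norm u' b <= sqrt K * l2norm u a.
Proof.
  intros Hu HK Ha H.
  change (sqrt (nsq u' b) <= sqrt K * sqrt (nsq u a)).
  rewrite <- sqrt_mult by auto using nsq_pos.
  apply sqrt_le_1_alt, H.
Qed.

(** [M] may be negative, but M times the norm dominates a nonnegative number, so squaring is still
    monotone here. *)
Lemma l2norm_le_nsq (u u' : nat -> R) (a b : nat -> C) (M : R) :
  (forall n, 0 <= u n) -> (forall n, 0 <= u' n) -> l2 u a -> l2 u' b ->
  l2norm u' b <= M * l2norm u a -> nsq u' b <= M ^ 2 * nsq u a.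
Proof.
  intros Hu Hu' Ha Hb H.
  pose proof (nsq_pos u Hu a Ha) as Pa; pose proof (nsq_pos u' Hu' b Hb) as Pb.
  change (sqrt (nsq u' b) <= M * sqrt (nsq u a)) in H.
  pose proof (sqrt_pos (nsq u' b)) as Q.
  rewrite <- (pow2_sqrt _ Pa), <- (pow2_sqrt _ Pb), <- Rpow_mult_distr.
  apply pow_incr; lra.
Qed.

Section Hilbert.
Variables (G : nat -> C) (v : nat -> R).
Hypothesis Hv : forall n, 0 < v n.

Let Hv0 (n : nat) : 0 <= v n := Rlt_le _ _ (Hv n).

Lemma dual_Cmod_pos (z : C) (n : nat) : dual G v z -> 0 < Cmod (z - G n)%C.
Proof. intros [H _]; apply Cmod_minus_pos, H. Qed.

(** Uses p q <= p^2 + q^2 with p = |a_n| and q = 1 / |z - G n|, both weighted by v_n. *)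
Lemma l2_dual_ex_series (a : nat -> C) (z : C) : l2 v a -> dual G v z ->
  ex_series (fun n => Cmod (a n) * v n * / Cmod (z - G n)%C).
Proof.
  intros Ha Hz.
  apply ex_series_dom with
    (fun n => Cmod (a n) ^ 2 * v n + v n / Cmod (z - G n)%C ^ 2).
  - intro n; pose proof (dual_Cmod_pos z n Hz) as P; pose proof (Hv n) as Pv.
    pose proof (Rinv_0_lt_compat _ P) as Pi; pose proof (Cmod_ge_0 (a n)).
    set (i := / Cmod (z - G n)%C) in *.
    replace (v n / Cmod (z - G n)%C ^ 2) with (v n * i ^ 2)
      by (unfold i; field; lra).
    split; [apply Rmult_le_pos; [apply Rmult_le_pos|]; lra|].
    pose proof (pow2_ge_0 (Cmod (a n) - i)).
    replace (Cmod (a n) ^ 2 * v n + v n * i ^ 2)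
      with (v n * (Cmod (a n) ^ 2 + i ^ 2)) by ring.
    replace (Cmod (a n) * v n * i) with (v n * (Cmod (a n) * i)) by ring.
    apply Rmult_le_compat_l; [lra|]; nra.
  - apply ex_series_plus_R; [exact Ha | apply Hz].
Qed.

Lemma Cmod_Hop_term (a : nat -> C) (z : C) (n : nat) : dual G v z ->
  Cmod (a n * RtoC (v n) * / (z - G n))%C = Cmod (a n) * v n * / Cmod (z - G n)%C.
Proof.
  intro Hz; rewrite !Cmod_mult, Cmod_R, Cmod_inv by (apply Cminus_neq_0, Hz).
  rewrite Rabs_right by (apply Rle_ge, Hv0); reflexivity.
Qed.

Lemma Hop_summable (a : nat -> C) (z : C) : l2 v a -> dual G v z ->
  summable (fun n => a n * RtoC (v n) * / (z - G n))%C.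
Proof.
  intros Ha Hz; eapply summable_dom; [|exact (l2_dual_ex_series a z Ha Hz)].
  intro n; right; apply Cmod_Hop_term, Hz.
Qed.

Lemma Hop_ext (a b : nat -> C) (z : C) : (forall n, a n = b n) -> Hop G v a z = Hop G v b z.
Proof. intro H; apply CSeries_ext; intro n; rewrite H; reflexivity. Qed.

Lemma Hop_plus (a b : nat -> C) (z : C) : l2 v a -> l2 v b -> dual G v z ->
  Hop G v (fun n => a n + b n)%C z = (Hop G v a z + Hop G v b z)%C.
Proof.
  intros Ha Hb Hz; unfold Hop; rewrite <- CSeries_plus by (apply Hop_summable; assumption).
  apply CSeries_ext; intro n; ring.
Qed.

Lemma Hop_scal (c : C) (a : nat -> C) (z : C) : l2 v a -> dual G v z ->
  Hop G v (fun n => c * a n)%C z = (c * Hop G v a z)%C.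
Proof.
  intros Ha Hz; unfold Hop; rewrite <- CSeries_scal by (apply Hop_summable; assumption).
  apply CSeries_ext; intro n; ring.
Qed.

Lemma Hop_minus (a b : nat -> C) (z : C) : l2 v a -> l2 v b -> dual G v z ->
  Hop G v (fun n => a n - b n)%C z = (Hop G v a z - Hop G v b z)%C.
Proof.
  intros Ha Hb Hz; unfold Hop; rewrite <- CSeries_minus by (apply Hop_summable; assumption).
  apply CSeries_ext; intro n; ring.
Qed.

Lemma Hop_0 (z : C) : Hop G v (fun _ => RtoC 0) z = RtoC 0.
Proof.
  transitivity (CSeries (fun _ => RtoC 0)); [apply CSeries_ext; intro n; ring | apply CSeries_0].
Qed.

Lemma Hop_cpsum (x : nat -> nat -> C) (N : nat) (z : C) :
  (forall j, l2 v (x j)) -> dual G v z ->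
  Hop G v (fun n => cpsum (fun j => x j n) N) z = cpsum (fun j => Hop G v (x j) z) N.
Proof.
  intros H Hz; induction N as [|N IH]; simpl; [apply Hop_0|].
  rewrite Hop_plus, IH; auto using l2_cpsum.
Qed.

(** * Dual systems of a uniqueness sequence are Cauchy-like *)

(** Divided difference of [h] along [G]; on the diagonal the numerator vanishes, so the value is
    0. *)
Definition diffq (h : nat -> R) (n k : nat) : C :=
  (RtoC (h n - h k) * / (G n - G k))%C.

(** Formally the commutator of multiplication by [h] with the Cauchy kernel 1 / (G n - G k); the
    numerator tames the singularity of the kernel on [G]. *)
Definition diffU (h : nat -> R) (x : nat -> C) (n : nat) : C :=
  CSeries (fun k => x k * RtoC (v k) * diffq h n k)%C.

Hypothesis HG : forall n m, G n = G m -> n = m.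

(** A mere Lipschitz bound on the divided difference would not do, because v need not be summable.
    Decay relative to a reference point [mu] of the dual set makes the series against any l2 vector
    converge. *)
Lemma diffq_bound (h : nat -> R) (mu : C) (K : R) (n k : nat) : dual G v mu -> 0 <= K ->
  Rabs (h n - h k) * Cmod (mu - G k)%C <= K * Cmod (G n - G k)%C ->
  Cmod (diffq h n k) <= K * / Cmod (mu - G k)%C.
Proof.
  intros Hmu HK HhK.
  assert (Pmu : 0 < Cmod (mu - G k)%C) by (apply dual_Cmod_pos, Hmu).
  assert (Pinv := Rinv_0_lt_compat _ Pmu).
  unfold diffq; destruct (Nat.eq_dec n k) as [<-|Hnk].
  - replace (h n - h n) with 0 by ring; rewrite Cmult_0_l, Cmod_0.
    apply Rmult_le_pos; lra.
  - assert (D : G n <> G k) by (intro E; apply Hnk, HG, E).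
    pose proof (Cmod_minus_pos _ _ D) as P; pose proof (Rinv_0_lt_compat _ P).
    rewrite Cmod_mult, Cmod_R, Cmod_inv by (apply Cminus_neq_0, D).
    apply Rmult_le_reg_r with (Cmod (mu - G k)%C * Cmod (G n - G k)%C);
      [apply Rmult_lt_0_compat; assumption|].
    replace (Rabs (h n - h k) * / Cmod (G n - G k)%C
             * (Cmod (mu - G k)%C * Cmod (G n - G k)%C))
      with (Rabs (h n - h k) * Cmod (mu - G k)%C) by (field; lra).
    replace (K * / Cmod (mu - G k)%C * (Cmod (mu - G k)%C * Cmod (G n - G k)%C))
      with (K * Cmod (G n - G k)%C) by (field; lra).
    exact HhK.
Qed.

Lemma diffq_term_bound (h : nat -> R) (mu : C) (K : R) (x : nat -> C) (n k : nat) :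
  dual G v mu -> 0 <= K ->
  Rabs (h n - h k) * Cmod (mu - G k)%C <= K * Cmod (G n - G k)%C ->
  Cmod (x k * RtoC (v k) * diffq h n k)%C
  <= K * (Cmod (x k) * v k * / Cmod (mu - G k)%C).
Proof.
  intros Hmu HK HhK.
  rewrite !Cmod_mult, Cmod_R, (Rabs_right (v k)) by (apply Rle_ge, Hv0).
  replace (K * (Cmod (x k) * v k * / Cmod (mu - G k)%C))
    with (Cmod (x k) * v k * (K * / Cmod (mu - G k)%C)) by ring.
  apply Rmult_le_compat_l; [apply Rmult_le_pos; [apply Cmod_ge_0 | apply Hv0]|].
  apply diffq_bound; assumption.
Qed.

(** * The commutator identity for a fixed bump *)

Section Commutator.
Variables (h : nat -> R) (mu : C) (K : R).
Hypothesis Hmu : dual G v mu.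
Hypothesis HK : 0 <= K.
Hypothesis Hh1 : forall n, Rabs (h n) <= 1.
Hypothesis HhK : forall n k,
  Rabs (h n - h k) * Cmod (mu - G k)%C <= K * Cmod (G n - G k)%C.

Let diffU_term_bound (x : nat -> C) (n k : nat) :
  Cmod (x k * RtoC (v k) * diffq h n k)%C
  <= K * (Cmod (x k) * v k * / Cmod (mu - G k)%C) :=
  diffq_term_bound h mu K x n k Hmu HK (HhK n k).

Lemma diffU_summable (x : nat -> C) (n : nat) : l2 v x ->
  summable (fun k => x k * RtoC (v k) * diffq h n k)%C.
Proof.
  intro Hx; eapply summable_dom; [intro k; apply diffU_term_bound|].
  apply ex_series_scal_R, l2_dual_ex_series; assumption.
Qed.

(** The bound on the k-th term of [diffU h x n] does not depend on n, so [diffU h x] is a bounded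
    multiplier. *)
Lemma diffU_mult_l2 (x y : nat -> C) : l2 v x -> l2 v y ->
  l2 v (fun n => diffU h x n * y n)%C.
Proof.
  intros Hx Hy.
  apply l2_mult with (K := Series (fun k => K * (Cmod (x k) * v k * / Cmod (mu - G k)%C)));
    [exact Hv0 | | exact Hy].
  intro n; apply Rle_trans with (1 := Cmod_CSeries_le_Series _ (diffU_summable x n Hx)).
  apply Series_le.
  - intro k; split; [apply Cmod_ge_0 | apply diffU_term_bound].
  - apply ex_series_scal_R, l2_dual_ex_series; assumption.
Qed.

Lemma l2_mult_h (x : nat -> C) : l2 v x -> l2 v (fun n => RtoC (h n) * x n)%C.
Proof.
  apply l2_mult with (K := 1); [exact Hv0|]; intro n; rewrite Cmod_R; apply Hh1.
Qed.

(* Antisymmetrising the double series turns the kernel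
   [(h n - h k) / ((G n - G k) (z - G n))] into [(h n - h k) / ((z - G n) (z - G k))],
   which splits into products of simple series. *)
Lemma Hop_commutator (a e : nat -> C) (z : C) : l2 v a -> l2 v e -> dual G v z ->
  Hop G v (fun n => diffU h e n * a n - diffU h a n * e n)%C z
  = (Hop G v e z * Hop G v (fun n => RtoC (h n) * a n)%C z
     - Hop G v a z * Hop G v (fun n => RtoC (h n) * e n)%C z)%C.
Proof.
  intros Ha He Hz.
  assert (Hha := l2_mult_h a Ha); assert (Hhe := l2_mult_h e He).
  rewrite Hop_minus by (auto using diffU_mult_l2).
  set (ta := fun n => (a n * RtoC (v n) * / (z - G n))%C).
  set (te := fun n => (e n * RtoC (v n) * / (z - G n))%C).
  assert (Sta : summable ta) by (apply Hop_summable; assumption).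
  assert (Ste : summable te) by (apply Hop_summable; assumption).
  set (F1 := fun n k => (ta n * (e k * RtoC (v k) * diffq h n k))%C).
  set (F2 := fun n k => (te k * (a n * RtoC (v n) * diffq h n k))%C).
  assert (Hsym : forall n k, diffq h n k = diffq h k n).
  { intros n k; unfold diffq; destruct (Nat.eq_dec n k) as [<-|Hnk]; [reflexivity|].
    rewrite !RtoC_minus; field; split; apply Cminus_neq_0; intro E;
      apply Hnk; [symmetry in E|]; apply HG, E || (symmetry; apply HG, E). }
  assert (E1 : Hop G v (fun n => diffU h e n * a n)%C z
               = CSeries (fun n => CSeries (fun k => F1 n k))).
  { apply CSeries_ext; intro n; unfold F1.
    rewrite CSeries_scal by (apply diffU_summable, He).
    unfold ta, diffU; ring. }
  (* In this double series the factor 1 / (z - G) sits on the other index; symmetry of [diffq] and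
     Fubini bring it to the same summation order as the first, so that the two can be subtracted
     termwise. *)
  assert (E2 : Hop G v (fun n => diffU h a n * e n)%C z
               = CSeries (fun n => CSeries (fun k => F2 n k))).
  { rewrite (CSeries_Fubini F2
      (fun n => K * (Cmod (a n) * v n * / Cmod (mu - G n)%C)) (fun k => Cmod (te k))).
    - apply CSeries_ext; intro k; unfold F2.
      rewrite (CSeries_ext _ (fun n => te k * (a n * RtoC (v n) * diffq h k n))%C)
        by (intro n; rewrite Hsym; reflexivity).
      rewrite CSeries_scal by (apply diffU_summable, Ha).
      unfold te, diffU; ring.
    - intros n k; unfold F2; rewrite Cmod_mult, Rmult_comm, Hsym.
      apply Rmult_le_compat_r; [apply Cmod_ge_0 | apply diffU_term_bound].
    (* The row index 0 is arbitrary: the bound dominates a modulus, hence is nonnegative. *)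
    - intro n; apply Rle_trans with (2 := diffU_term_bound a 0 n); apply Cmod_ge_0.
    - intro k; apply Cmod_ge_0.
    - apply ex_series_scal_R, l2_dual_ex_series; assumption.
    - exact Ste. }
  assert (SF1 : forall n, summable (F1 n)) by
    (intro n; apply summable_scal, diffU_summable, He).
  assert (SF2 : forall n, summable (F2 n)).
  { intro n; eapply summable_dom with
      (B := fun k => K * (Cmod (a n) * v n * / Cmod (mu - G n)%C) * Cmod (te k)).
    - intro k; unfold F2; rewrite Cmod_mult, Rmult_comm, Hsym.
      apply Rmult_le_compat_r; [apply Cmod_ge_0 | apply diffU_term_bound].
    - apply ex_series_scal_R, Ste. }
  assert (SG1 : summable (fun n => CSeries (fun k => F1 n k))).
  { apply summable_ext with (2 := Hop_summable _ z (diffU_mult_l2 e a He Ha) Hz).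
    intro n; unfold F1; rewrite CSeries_scal by (apply diffU_summable, He).
    unfold ta, diffU; ring. }
  assert (SG2 : summable (fun n => CSeries (fun k => F2 n k))).
  { eapply summable_dom with (B := fun n => Series (fun k => Cmod (te k)) *
      (K * (Cmod (a n) * v n * / Cmod (mu - G n)%C))).
    - intro n; apply Rle_trans with (1 := Cmod_CSeries_le_Series _ (SF2 n)).
      rewrite <- Series_scal_r; apply Series_le; [|apply ex_series_scal_r, Ste].
      intro k; split; [apply Cmod_ge_0|].
      unfold F2; rewrite Cmod_mult, Hsym.
      apply Rmult_le_compat_l; [apply Cmod_ge_0 | apply diffU_term_bound].
    - apply ex_series_scal_R, ex_series_scal_R, l2_dual_ex_series; assumption. }
  rewrite E1, E2, <- CSeries_minus by assumption.
  rewrite (CSeries_ext _ (fun n => Hop G v e z * (RtoC (h n) * a n * RtoC (v n) * / (z - G n))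
     - Hop G v (fun n => RtoC (h n) * e n)%C z * ta n)%C).
  - rewrite CSeries_minus by (apply summable_scal; auto using Hop_summable).
    rewrite !CSeries_scal by (auto using Hop_summable).
    change (CSeries ta) with (Hop G v a z).
    change (CSeries (fun n => RtoC (h n) * a n * RtoC (v n) * / (z - G n))%C)
      with (Hop G v (fun n => RtoC (h n) * a n)%C z).
    ring.
  (* 1 / (z - G n) - 1 / (z - G k) produces the factor G n - G k, which cancels the denominator of
     [diffq]. What remains is (h n - h k) [ta n] [te k]; on the diagonal both sides vanish. *)
  - intro n; rewrite <- CSeries_minus by auto.
    rewrite (CSeries_ext _ (fun k => (RtoC (h n) * ta n) * te k
      - ta n * (RtoC (h k) * e k * RtoC (v k) * / (z - G k)))%C).
    + rewrite CSeries_minus by (apply summable_scal; auto;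
        apply (Hop_summable _ z Hhe Hz)).
      rewrite !CSeries_scal by (auto; apply (Hop_summable _ z Hhe Hz)).
      change (CSeries te) with (Hop G v e z).
      change (CSeries (fun k => RtoC (h k) * e k * RtoC (v k) * / (z - G k))%C)
        with (Hop G v (fun n => RtoC (h n) * e n)%C z).
      unfold ta; ring.
    + intro k; unfold F1, F2, ta, te, diffq.
      assert (Zn := Cminus_neq_0 _ _ (proj1 Hz n)).
      assert (Zk := Cminus_neq_0 _ _ (proj1 Hz k)).
      destruct (Nat.eq_dec n k) as [<-|Hnk].
      * replace (h n - h n) with 0 by ring; ring.
      * assert (D : (G n - G k)%C <> RtoC 0)
          by (apply Cminus_neq_0; intro E; apply Hnk, HG, E).
        rewrite RtoC_minus; field; auto.
Qed.

End Commutator.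

(** A peak of height 1 and width about 1/s at [G m]. For fixed s it is s-Lipschitz on [G], and it
    tends pointwise to the indicator of m. *)
Definition bump (m s n : nat) : R := / (1 + INR s * Cmod (G n - G m)%C).

Lemma Rabs_bump_le_1 (m s n : nat) : Rabs (bump m s n) <= 1.
Proof.
  unfold bump.
  assert (P : 0 <= INR s * Cmod (G n - G m)%C)
    by (apply Rmult_le_pos; [apply pos_INR | apply Cmod_ge_0]).
  rewrite Rabs_right by (apply Rle_ge, Rlt_le, Rinv_0_lt_compat; lra).
  rewrite <- Rinv_1; apply Rinv_le_contravar; lra.
Qed.

Lemma bump_self (m s : nat) : bump m s m = 1.
Proof.
  unfold bump; replace (G m - G m)%C with (RtoC 0) by ring.
  rewrite Cmod_0; field.
Qed.

Lemma bump_lim (m n : nat) : n <> m -> is_lim_seq (fun s => bump m s n) 0.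
Proof.
  intro H.
  assert (P : 0 < Cmod (G n - G m)%C) by (apply Cmod_minus_pos; intro E; apply H, HG, E).
  unfold bump; replace (Finite 0) with (Rbar_inv p_infty) by reflexivity.
  apply is_lim_seq_inv; [|discriminate].
  apply is_lim_seq_plus with 1 p_infty; [apply is_lim_seq_const| |reflexivity].
  apply is_lim_seq_mult with p_infty (Cmod (G n - G m)%C);
    [apply is_lim_seq_INR | apply is_lim_seq_const|].
  apply is_Rbar_mult_p_infty_pos, P.
Qed.

(** The difference is s (Y - X) / ((1 + s X) (1 + s Y)). The first bound uses that the denominator
    is at least 1, the second that it is at least s X. *)
Lemma inv_affine_diff (s X Y : R) : 0 <= s -> 0 <= X -> 0 <= Y ->
  Rabs (/ (1 + s * X) - / (1 + s * Y)) <= s * Rabs (X - Y) /\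
  Rabs (/ (1 + s * X) - / (1 + s * Y)) * X <= Rabs (X - Y).
Proof.
  intros Hs HX HY.
  assert (PX : 0 <= s * X) by (apply Rmult_le_pos; assumption).
  assert (PY : 0 <= s * Y) by (apply Rmult_le_pos; assumption).
  assert (PXY : 0 <= s * X * (s * Y)) by (apply Rmult_le_pos; assumption).
  assert (Pd : 0 < / ((1 + s * X) * (1 + s * Y)))
    by (apply Rinv_0_lt_compat, Rmult_lt_0_compat; lra).
  assert (E : Rabs (/ (1 + s * X) - / (1 + s * Y))
              = s * Rabs (X - Y) * / ((1 + s * X) * (1 + s * Y))).
  { replace (/ (1 + s * X) - / (1 + s * Y))
      with (s * (Y - X) * / ((1 + s * X) * (1 + s * Y))) by (field; lra).
    rewrite !Rabs_mult, (Rabs_right s), (Rabs_right (/ _)) by lra.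
    rewrite Rabs_minus_sym; reflexivity. }
  assert (I : (1 + s * X) * (1 + s * Y) * / ((1 + s * X) * (1 + s * Y)) = 1)
    by (field; lra).
  set (i := / ((1 + s * X) * (1 + s * Y))) in *.
  rewrite E; pose proof (Rabs_pos (X - Y)) as PA.
  split.
  - apply Rle_trans with (s * Rabs (X - Y) * 1); [|right; ring].
    apply Rmult_le_compat_l; [apply Rmult_le_pos; assumption|]; clear E; clearbody i; nra.
  - replace (s * Rabs (X - Y) * i * X) with (Rabs (X - Y) * (s * X * i)) by ring.
    apply Rle_trans with (Rabs (X - Y) * 1); [|right; ring].
    apply Rmult_le_compat_l; [assumption|]; clear E; clearbody i; nra.
Qed.

Lemma Rabs_Cmod_minus (x y c : C) :
  Rabs (Cmod (x - c)%C - Cmod (y - c)%C) <= Cmod (x - y)%C.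
Proof.
  apply Rabs_le; split.
  - pose proof (Cmod_triangle (y - x)%C (x - c)%C) as E.
    replace (y - x + (x - c))%C with (y - c)%C in E by ring.
    rewrite (Cmod_minus_sym y x) in E; lra.
  - pose proof (Cmod_triangle (x - y)%C (y - c)%C) as E.
    replace (x - y + (y - c))%C with (x - c)%C in E by ring; lra.
Qed.

(** The first bound degrades with s and serves for a fixed bump. The other two are uniform in s,
    which is what allows domination as the bump shrinks. *)
Lemma bump_diff (m s n k : nat) :
  Rabs (bump m s n - bump m s k) <= INR s * Cmod (G n - G k)%C /\
  Rabs (bump m s n - bump m s k) * Cmod (G n - G m)%C <= Cmod (G n - G k)%C /\
  Rabs (bump m s n - bump m s k) * Cmod (G k - G m)%C <= Cmod (G n - G k)%C.
Proof.
  pose proof (pos_INR s) as Ps.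
  pose proof (Cmod_ge_0 (G n - G m)%C) as Pn; pose proof (Cmod_ge_0 (G k - G m)%C) as Pk.
  destruct (inv_affine_diff _ _ _ Ps Pn Pk) as [A B].
  destruct (inv_affine_diff _ _ _ Ps Pk Pn) as [_ B'].
  pose proof (Rabs_Cmod_minus (G n) (G k) (G m)) as T.
  pose proof (Rabs_Cmod_minus (G k) (G n) (G m)) as T'.
  rewrite (Cmod_minus_sym (G k) (G n)) in T'.
  unfold bump; split; [|split; [lra|]].
  - apply Rle_trans with (1 := A), Rmult_le_compat_l; assumption.
  - rewrite Rabs_minus_sym; lra.
Qed.

(** By the triangle inequality through [G m]; the part containing |G k - G m| is absorbed by the
    last clause of [bump_diff]. *)
Lemma bump_mu (mu : C) (m s n k : nat) :
  Rabs (bump m s n - bump m s k) * Cmod (mu - G k)%C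
  <= Rabs (bump m s n - bump m s k) * Cmod (mu - G m)%C + Cmod (G n - G k)%C.
Proof.
  destruct (bump_diff m s n k) as (_ & _ & D).
  pose proof (Cmod_minus_triangle (mu - G m)%C (G k - G m)%C) as E.
  replace (mu - G m - (G k - G m))%C with (mu - G k)%C in E by ring.
  pose proof (Rabs_pos (bump m s n - bump m s k)).
  apply Rle_trans with (Rabs (bump m s n - bump m s k)
    * (Cmod (mu - G m)%C + Cmod (G k - G m)%C)); [apply Rmult_le_compat_l; assumption|].
  lra.
Qed.

Lemma CSeries_single (f : nat -> C) (m : nat) :
  (forall k, k <> m -> f k = RtoC 0) -> CSeries f = f m.
Proof.
  intro H.
  assert (S1 : forall g : nat -> R, (forall k, k <> m -> g k = 0) -> Series g = g m).
  { intros g Hg; apply is_series_unique.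
    apply is_series_ext with (trunc 0 (S m) g).
    - intro n; unfold trunc; destruct (Nat.ltb n (S m)) eqn:E; [reflexivity|].
      apply Nat.ltb_ge in E; symmetry; apply Hg; lia.
    - replace (g m) with (psum g (S m)); [apply is_series_trunc|].
      simpl; replace (psum g m) with 0; [ring|].
      rewrite (psum_ext g (fun _ => 0 * 0)) by (intros n Hn; rewrite Hg by lia; ring).
      rewrite psum_scal; ring. }
  unfold CSeries; rewrite (S1 (fun n => Re (f n))), (S1 (fun n => Im (f n)));
    try (intros k Hk; rewrite H by exact Hk; reflexivity).
  destruct (f m); reflexivity.
Qed.

Lemma Clim_RtoC (u : nat -> R) (l : R) :
  is_lim_seq u l -> Clim (fun s => RtoC (u s)) (RtoC l).
Proof.
  intro H; apply Clim_le_0 with (fun s => Rabs (u s - l)).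
  - intro s; rewrite <- RtoC_minus, Cmod_R; apply Rle_refl.
  - rewrite <- Rabs_R0 at 1; apply (is_lim_seq_abs _ (Finite 0)).
    replace (Finite 0) with (Finite (l - l)) by (f_equal; ring).
    apply is_lim_seq_minus'; [exact H | apply is_lim_seq_const].
Qed.

Definition ind (m k : nat) : R := if Nat.eqb k m then 1 else 0.

Lemma bump_lim_ind (m k : nat) : is_lim_seq (fun s => bump m s k) (ind m k).
Proof.
  unfold ind; destruct (Nat.eqb_spec k m) as [->|H].
  - apply is_lim_seq_ext with (fun _ => 1);
      [intro; symmetry; apply bump_self | apply is_lim_seq_const].
  - apply bump_lim, H.
Qed.

(** Bumps are at most 1, so the series is dominated by its own terms without the bump; in the limit
    only the m-th term survives. *)
Lemma Hop_bump_lim (m : nat) (x : nat -> C) (z : C) : l2 v x -> dual G v z ->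
  Clim (fun s => Hop G v (fun n => RtoC (bump m s n) * x n)%C z)
       (x m * RtoC (v m) * / (z - G m))%C.
Proof.
  intros Hx Hz.
  replace (x m * RtoC (v m) * / (z - G m))%C with
    (CSeries (fun n => RtoC (ind m n) * (x n * RtoC (v n) * / (z - G n)))%C).
  - apply dominated_CSeries with (fun n => Cmod (x n) * v n * / Cmod (z - G n)%C).
    + intros s k; rewrite <- (Cmod_Hop_term x z k Hz).
      replace (RtoC (bump m s k) * x k * RtoC (v k) * / (z - G k))%C
        with (RtoC (bump m s k) * (x k * RtoC (v k) * / (z - G k)))%C by ring.
      rewrite Cmod_mult, Cmod_R, <- Rmult_1_l.
      apply Rmult_le_compat_r; [apply Cmod_ge_0 | apply Rabs_bump_le_1].
    + apply l2_dual_ex_series; assumption.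
    + intro k; apply Clim_ext with
        (fun s => (x k * RtoC (v k) * / (z - G k)) * RtoC (bump m s k))%C; [intro; ring|].
      rewrite (Cmult_comm (RtoC (ind m k))); apply Clim_scal, Clim_RtoC, bump_lim_ind.
  - rewrite (CSeries_single _ m); unfold ind.
    + rewrite Nat.eqb_refl; ring.
    + intros k Hk; apply Nat.eqb_neq in Hk; rewrite Hk; ring.
Qed.

Lemma diffU_bump_lim (m n : nat) (x : nat -> C) (mu : C) :
  l2 v x -> dual G v mu -> n <> m ->
  Clim (fun s => diffU (bump m s) x n) (- (x m * RtoC (v m) * / (G n - G m)))%C.
Proof.
  intros Hx Hmu Hnm.
  assert (D : G n <> G m) by (intro E; apply Hnm, HG, E).
  assert (P := Cmod_minus_pos _ _ D).
  (* Independent of s, at the price of fixing n different from m: |mu - G m| is rewritten as a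
     multiple of |G n - G m|, to which a uniform clause of [bump_diff] applies. *)
  set (K := Cmod (mu - G m)%C * / Cmod (G n - G m)%C + 1).
  assert (HK : 0 <= K).
  { unfold K; pose proof (Cmod_ge_0 (mu - G m)%C); pose proof (Rinv_0_lt_compat _ P).
    assert (0 <= Cmod (mu - G m)%C * / Cmod (G n - G m)%C) by (apply Rmult_le_pos; lra); lra. }
  replace (- (x m * RtoC (v m) * / (G n - G m)))%C with
    (CSeries (fun k => x k * RtoC (v k) * diffq (ind m) n k)%C).
  - apply dominated_CSeries with (fun k => K * (Cmod (x k) * v k * / Cmod (mu - G k)%C)).
    + intros s k; apply diffq_term_bound; [exact Hmu | exact HK|].
      apply Rle_trans with (1 := bump_mu mu m s n k).
      destruct (bump_diff m s n k) as (_ & B & _).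
      unfold K; rewrite Rmult_plus_distr_r, Rmult_1_l.
      apply Rplus_le_compat_r.
      replace (Rabs (bump m s n - bump m s k) * Cmod (mu - G m)%C)
        with (Cmod (mu - G m)%C * / Cmod (G n - G m)%C
              * (Rabs (bump m s n - bump m s k) * Cmod (G n - G m)%C)) by (field; lra).
      apply Rmult_le_compat_l; [|exact B].
      unfold K in HK; apply Rmult_le_pos; [apply Cmod_ge_0|].
      apply Rlt_le, Rinv_0_lt_compat, P.
    + apply ex_series_scal_R, l2_dual_ex_series; assumption.
    + intro k; unfold diffq.
      apply Clim_ext with (fun s => (x k * RtoC (v k) * / (G n - G k))
        * RtoC (bump m s n - bump m s k))%C; [intro; ring|].
      replace (x k * RtoC (v k) * (RtoC (ind m n - ind m k) * / (G n - G k)))%C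
        with (x k * RtoC (v k) * / (G n - G k) * RtoC (ind m n - ind m k))%C by ring.
      apply Clim_scal, Clim_RtoC, is_lim_seq_minus'; apply bump_lim_ind.
  - assert (En : ind m n = 0) by (unfold ind; apply Nat.eqb_neq in Hnm; rewrite Hnm; reflexivity).
    rewrite (CSeries_single _ m); unfold diffq; rewrite En.
    + unfold ind; rewrite Nat.eqb_refl.
      replace (0 - 1) with (- (1)) by ring; rewrite RtoC_opp; ring.
    + intros k Hk; unfold ind; apply Nat.eqb_neq in Hk; rewrite Hk.
      replace (0 - 0) with 0 by ring; ring.
Qed.

(* [Hop_commutator] provides an element of l2 whose transform vanishes on [L] away from
   [L i] and [L k], hence a combination of [e] and [a]; shrinking the bump to [G m]
   isolates the m-th coefficients. *)
Lemma dual_system_proportional (L : nat -> C) (i k : nat) (e a : nat -> C) :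
  uniqueness_seq G v L -> i <> k -> l2 v e -> l2 v a ->
  Hop G v e (L i) = RtoC 1 -> (forall j, j <> i -> Hop G v e (L j) = RtoC 0) ->
  Hop G v a (L k) = RtoC 1 -> (forall j, j <> k -> Hop G v a (L j) = RtoC 0) ->
  forall n m, (e n * a m * (L i - G n) * (L k - G m)
               = a n * e m * (L k - G n) * (L i - G m))%C.
Proof.
  intros (_ & HL & Huniq) Hik He Ha Hei He0 Hak Ha0 n m.
  destruct (Nat.eq_dec n m) as [->|Hnm]; [ring|].
  (* The vector given by the commutator identity has transform P at [L i], -Q at [L k] and 0
     elsewhere on [L]; by uniqueness it equals P e - Q a. *)
  set (P := fun s => Hop G v (fun n => RtoC (bump m s n) * a n)%C (L i)).
  set (Q := fun s => Hop G v (fun n => RtoC (bump m s n) * e n)%C (L k)).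
  assert (Key : forall s, (a n * diffU (bump m s) e n - e n * diffU (bump m s) a n
                           = e n * P s - a n * Q s)%C).
  { intro s.
    (* This constant may grow with s, since for each s only membership in l2 and the identity itself
       are needed. *)
    set (K := INR s * Cmod (L i - G m)%C + 1).
    assert (HK : 0 <= K).
    { assert (0 <= INR s * Cmod (L i - G m)%C)
        by (apply Rmult_le_pos; [apply pos_INR | apply Cmod_ge_0]).
      unfold K; lra. }
    assert (HhK : forall n k, Rabs (bump m s n - bump m s k) * Cmod (L i - G k)%C
                              <= K * Cmod (G n - G k)%C).
    { intros n' k'; apply Rle_trans with (1 := bump_mu (L i) m s n' k').
      destruct (bump_diff m s n' k') as (B & _ & _).
      unfold K; rewrite Rmult_plus_distr_r, Rmult_1_l.
      apply Rplus_le_compat_r.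
      rewrite Rmult_assoc, (Rmult_comm (Cmod (L i - G m)%C)), <- Rmult_assoc.
      apply Rmult_le_compat_r; [apply Cmod_ge_0 | exact B]. }
    pose proof (diffU_mult_l2 _ _ _ (HL i) HK HhK) as Hl2.
    assert (Hb : l2 v (fun n => diffU (bump m s) e n * a n - diffU (bump m s) a n * e n)%C)
      by (apply l2_minus; auto).
    assert (Hc : l2 v (fun n => P s * e n - Q s * a n)%C)
      by (apply l2_minus; auto using l2_scal).
    pose proof (Huniq _ (l2_minus v Hv0 _ _ Hb Hc)) as U.
    assert (E : forall n, (diffU (bump m s) e n * a n - diffU (bump m s) a n * e n
      - (P s * e n - Q s * a n))%C = RtoC 0).
    { apply U; intro j.
      rewrite (Hop_minus _ _ _ Hb Hc (HL j)).
      rewrite (Hop_commutator _ _ _ (HL i) HK (Rabs_bump_le_1 m s) HhK) by auto.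
      rewrite (Hop_minus _ _ _ (l2_scal v Hv0 (P s) e He) (l2_scal v Hv0 (Q s) a Ha) (HL j)).
      rewrite !Hop_scal by auto.
      destruct (Nat.eq_dec j i) as [->|Hji]; [|destruct (Nat.eq_dec j k) as [->|Hjk]].
      - rewrite Hei, (Ha0 i) by exact Hik; fold (P s); ring.
      - rewrite Hak, (He0 k) by (intro; apply Hik; auto); fold (Q s); ring.
      - rewrite (He0 j Hji), (Ha0 j Hjk); ring. }
    specialize (E n).
    replace (a n * diffU (bump m s) e n - e n * diffU (bump m s) a n)%C with
      ((diffU (bump m s) e n * a n - diffU (bump m s) a n * e n
        - (P s * e n - Q s * a n)) + (P s * e n - Q s * a n))%C by ring.
    rewrite E; ring. }
  assert (Lim : (a n * - (e m * RtoC (v m) * / (G n - G m))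
                 - e n * - (a m * RtoC (v m) * / (G n - G m))
                 = e n * (a m * RtoC (v m) * / (L i - G m))
                   - a n * (e m * RtoC (v m) * / (L k - G m)))%C).
  { apply Clim_unique with
      (fun s => a n * diffU (bump m s) e n - e n * diffU (bump m s) a n)%C.
    - apply Clim_minus; apply Clim_scal, diffU_bump_lim with (L i); auto.
    - apply Clim_ext with (fun s => e n * P s - a n * Q s)%C; [intro; symmetry; apply Key|].
      apply Clim_minus; apply Clim_scal.
      + exact (Hop_bump_lim m a (L i) Ha (HL i)).
      + exact (Hop_bump_lim m e (L k) He (HL k)). }
  assert (Dnm : (G n - G m)%C <> RtoC 0)
    by (apply Cminus_neq_0; intro E; apply Hnm, HG, E).
  assert (Di : (L i - G m)%C <> RtoC 0) by apply Cminus_neq_0, HL.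
  assert (Dk : (L k - G m)%C <> RtoC 0) by apply Cminus_neq_0, HL.
  assert (Dv : RtoC (v m) <> RtoC 0)
    by (intro E; injection E; intro E'; pose proof (Hv m); lra).
  (* The desired difference is the limit identity multiplied by its common denominator and divided
     by v_m. *)
  assert (Z : (e n * a m * (L i - G n) * (L k - G m)
               - a n * e m * (L k - G n) * (L i - G m)
    = (a n * - (e m * RtoC (v m) * / (G n - G m))
                 - e n * - (a m * RtoC (v m) * / (G n - G m))
       - (e n * (a m * RtoC (v m) * / (L i - G m))
                   - a n * (e m * RtoC (v m) * / (L k - G m))))
      * ((G n - G m) * (L i - G m) * (L k - G m) * / RtoC (v m)))%C)
    by (field; auto).
  rewrite Lim in Z.
  match type of Z with ?A = _ =>
    assert (Z' : A = RtoC 0) by (rewrite Z; ring) end.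
  match type of Z' with Cminus ?A ?B = _ =>
    replace A with ((A - B) + B)%C by ring; rewrite Z'; ring end.
Qed.

End Hilbert.

(** * Synthesis from a Bessel system *)

Lemma l2_Fatou (u : nat -> R) (y : nat -> nat -> C) (z : nat -> C) (K : R) :
  (forall n, 0 <= u n) -> (forall N, l2 u (y N)) -> (forall N, nsq u (y N) <= K) ->
  (forall n, Clim (fun N => y N n) (z n)) -> l2 u z /\ nsq u z <= K.
Proof.
  intros Hu Hy HK Hz; apply ex_series_bounded; [apply l2_term_pos, Hu|].
  intro P.
  apply (is_lim_seq_le (fun N => psum (fun n => Cmod (y N n) ^ 2 * u n) P) (fun _ => K)
           (psum (fun n => Cmod (z n) ^ 2 * u n) P) K).
  - intro N; apply Rle_trans with (2 := HK N).
    apply psum_le_Series; [apply l2_term_pos, Hu | apply Hy].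
  - apply (psum_lim_pointwise (fun N n => Cmod (y N n) ^ 2 * u n)); intro n.
    replace (Finite (Cmod (z n) ^ 2 * u n)) with
      (Rbar_mult (Cmod (z n) * Cmod (z n)) (u n)) by (simpl; f_equal; ring).
    apply is_lim_seq_ext with (fun N => Cmod (y N n) * Cmod (y N n) * u n); [intro; ring|].
    apply is_lim_seq_scal_r, is_lim_seq_mult'; apply Clim_Cmod, Hz.
  - apply is_lim_seq_const.
Qed.

Section Synthesis.
Variables (v w : nat -> R) (x : nat -> nat -> C) (K : R).
Hypothesis Hv : forall n, 0 < v n.
Hypothesis Hw : forall j, 0 < w j.
Hypothesis Hx : forall j, l2 v (x j).

Definition comb (N : nat) (b : nat -> C) (n : nat) : C :=
  cpsum (fun j => b j * x j n)%C N.

Definition synth (b : nat -> C) (n : nat) : C := CSeries (fun j => b j * x j n)%C.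

Let Hv0 (n : nat) : 0 <= v n := Rlt_le _ _ (Hv n).

Lemma comb_l2 (N : nat) (b : nat -> C) : l2 v (comb N b).
Proof. apply (l2_cpsum v Hv0 (fun j n => b j * x j n)%C); intro j; apply l2_scal; auto. Qed.

Hypothesis HK : forall N b,
  nsq v (comb N b) <= K * psum (fun j => Cmod (b j) ^ 2 * w j) N.

(** Test the Bessel bound on the extremal sequence of Cauchy-Schwarz, b_j = conj (x_j n) / w_j. With
    s the partial sum, the n-th coordinate of the combination and the weighted square sum of b both
    equal s, so s^2 v_n <= K s. *)
Lemma coefficient_bound (n : nat) : ex_series (fun j => Cmod (x j n) ^ 2 * / w j).
Proof.
  assert (P : forall j, 0 <= Cmod (x j n) ^ 2 * / w j).
  { intro j; apply Rmult_le_pos; [apply pow2_Cmod_pos|].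
    apply Rlt_le, Rinv_0_lt_compat, Hw. }
  apply (ex_series_bounded _ (K * / v n) P); intro N.
  set (b := fun j => (Cconj (x j n) * RtoC (/ w j))%C).
  set (s := psum (fun j => Cmod (x j n) ^ 2 * / w j) N).
  assert (E1 : comb N b n = RtoC s).
  { unfold comb, s, b; clear; induction N as [|N IH]; simpl; [reflexivity|].
    rewrite IH, RtoC_plus; f_equal.
    rewrite RtoC_mult; replace (RtoC (Cmod (x N n) * (Cmod (x N n) * 1)))
      with (x N n * Cconj (x N n))%C by (rewrite <- Cmod2_conj, RtoC_pow; simpl;
        rewrite !RtoC_mult; reflexivity); ring. }
  assert (E2 : psum (fun j => Cmod (b j) ^ 2 * w j) N = s).
  { apply psum_ext; intros j _; unfold b.
    pose proof (Hw j) as Wj; pose proof (Rinv_0_lt_compat _ Wj).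
    rewrite Cmod_mult, Cmod_conj, Cmod_R, Rabs_right by lra; field; lra. }
  pose proof (HK N b) as B; rewrite E2 in B.
  pose proof (term_le_nsq v Hv0 _ n (comb_l2 N b)) as T.
  rewrite E1, Cmod_R, pow2_abs in T.
  assert (S0 : 0 <= s) by (apply psum_pos, P).
  pose proof (Hv n) as Vn.
  apply Rmult_le_reg_r with (1 := Vn).
  replace (K * / v n * v n) with K by (field; lra).
  destruct (Req_dec s 0) as [Z|Z].
  (* When s = 0 the claim is K >= 0, read off from the Bessel bound with one vector and coefficient
     1. *)
  - rewrite Z, Rmult_0_l.
    pose proof (HK 1 (fun _ => RtoC 1)) as B1; simpl in B1; rewrite Cmod_1 in B1.
    pose proof (nsq_pos v Hv0 _ (comb_l2 1 (fun _ => RtoC 1))) as B2.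
    pose proof (Hw 0%nat); nra.
  - apply Rmult_le_reg_l with s; [lra|]; lra.
Qed.

Lemma synth_summable (b : nat -> C) (n : nat) : l2 w b ->
  summable (fun j => b j * x j n)%C.
Proof.
  intro Hb; apply summable_dom with
    (fun j => Cmod (b j) ^ 2 * w j + Cmod (x j n) ^ 2 * / w j).
  - intro j; rewrite Cmod_mult.
    pose proof (Hw j) as Wj; pose proof (Rinv_0_lt_compat _ Wj) as Ij.
    pose proof (Cmod_ge_0 (b j)); pose proof (Cmod_ge_0 (x j n)).
    assert (0 <= (Cmod (b j) * w j - Cmod (x j n)) ^ 2 * / w j)
      by (apply Rmult_le_pos; [apply pow2_ge_0 | lra]).
    assert (0 <= Cmod (b j) * Cmod (x j n)) by (apply Rmult_le_pos; assumption).
    replace (Cmod (b j) ^ 2 * w j + Cmod (x j n) ^ 2 * / w j) with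
      ((Cmod (b j) * w j - Cmod (x j n)) ^ 2 * / w j + 2 * (Cmod (b j) * Cmod (x j n)))
      by (field; lra).
    lra.
  - apply ex_series_plus_R; [exact Hb | apply coefficient_bound].
Qed.

Hypothesis HK0 : 0 <= K.

(** Only coordinatewise convergence of the finite combinations is needed: Fatou passes their uniform
    bound to the limit. *)
Lemma synth_bound (b : nat -> C) : l2 w b ->
  l2 v (synth b) /\ nsq v (synth b) <= K * nsq w b.
Proof.
  intro Hb; apply (l2_Fatou v (fun N => comb N b)); auto.
  - intro N; apply comb_l2.
  - intro N; apply Rle_trans with (1 := HK N b), Rmult_le_compat_l; [exact HK0|].
    apply psum_le_Series; [apply l2_term_pos; intro; apply Rlt_le, Hw | exact Hb].
  - intro n; apply cpsum_lim, synth_summable, Hb.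
Qed.

(** This is [synth_bound] for the tail of b, because subtracting [comb N b] removes the first N
    coefficients. *)
Lemma synth_tail (b : nat -> C) (N : nat) : l2 w b ->
  l2 v (fun n => synth b n - comb N b n)%C /\
  nsq v (fun n => synth b n - comb N b n)%C
  <= K * (nsq w b - psum (fun j => Cmod (b j) ^ 2 * w j) N).
Proof.
  intro Hb.
  assert (Hw0 : forall j, 0 <= w j) by (intro; apply Rlt_le, Hw).
  set (t := fun j => (b j - trunc (RtoC 0) N b j)%C).
  assert (Ht : l2 w t) by (apply l2_minus; auto using l2_trunc).
  destruct (synth_bound t Ht) as [A B].
  unfold t in B; rewrite nsq_tail in B by assumption; fold t in B.
  assert (E : forall n, synth t n = (synth b n - comb N b n)%C).
  { intro n; unfold synth, comb; rewrite <- CSeries_trunc.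
    rewrite <- CSeries_minus by (auto using synth_summable, summable_trunc).
    apply CSeries_ext; intro j; unfold t, trunc; destruct (Nat.ltb j N); ring. }
  split; [apply l2_ext with (2 := A), E|].
  rewrite <- (nsq_ext v _ _ E); exact B.
Qed.

End Synthesis.

(** * The dual system generated by one vector *)

Section Main.
Variables (G : nat -> C) (v : nat -> R) (L : nat -> C).
Hypothesis HG : forall n m, G n = G m -> n = m.
Hypothesis Hv : forall n, 0 < v n.
Hypothesis HLinj : forall j k, L j = L k -> j = k.
Hypothesis HL : forall j, dual G v (L j).

Let Hv0 (n : nat) : 0 <= v n := Rlt_le _ _ (Hv n).
Let w := bessel_weight G v L.

Lemma bessel_weight_pos (j : nat) : 0 < bessel_weight G v L j.
Proof.
  unfold bessel_weight; apply Rinv_0_lt_compat.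
  assert (T : forall n, 0 < v n / Cmod (L j - G n)%C ^ 2).
  { intro n; apply Rmult_lt_0_compat; [apply Hv|].
    apply Rinv_0_lt_compat, pow_lt, dual_Cmod_pos with v, HL. }
  apply Rlt_le_trans with (1 := T 0%nat).
  apply (term_le_Series (fun n => v n / Cmod (L j - G n)%C ^ 2));
    [intro; apply Rlt_le, T | apply HL].
Qed.

Let Hw : forall j, 0 < w j := bessel_weight_pos.
Let Hw0 (j : nat) : 0 <= w j := Rlt_le _ _ (Hw j).

Section Dual.
Variable e : nat -> C.

(** Normalisation at [L k]. From (L 0 - G n) / (L k - G n) = 1 + (L 0 - L k) / (L k - G n) and the
    vanishing of the transform of e at [L k], the unnormalised vector has transform (L 0 - L k)
    sum_n e_n v_n / (L k - G n)^2 there. At k = 0 the vector is e itself. *)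
Definition kappa (k : nat) : C :=
  match k with
  | O => RtoC 1
  | S _ => / ((L 0%nat - L k) *
      CSeries (fun n => e n * RtoC (v n) * / ((L k - G n) * (L k - G n))))
  end%C.

Definition dual_system (k n : nat) : C :=
  (kappa k * (e n * (L 0%nat - G n) * / (L k - G n)))%C.

Hypothesis Huniq : uniqueness_seq G v L.
Hypothesis Hexact : forall k, exists a, l2 v a /\ (exists n, a n <> RtoC 0) /\
  (forall j, j <> k -> Hop G v a (L j) = RtoC 0).
Hypothesis He : l2 v e.
Hypothesis He1 : Hop G v e (L 0%nat) = RtoC 1.
Hypothesis He0 : forall j, j <> 0%nat -> Hop G v e (L j) = RtoC 0.

Lemma LG_neq_0 (j n : nat) : (L j - G n)%C <> RtoC 0.
Proof. apply Cminus_neq_0, HL. Qed.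

Lemma Hop_nonzero (a : nat -> C) (z : C) :
  Hop G v a z <> RtoC 0 -> exists n, a n <> RtoC 0.
Proof.
  intro H; apply NNPP; intro N; apply H.
  rewrite <- (Hop_0 G v z) at 1; apply Hop_ext; intro n.
  apply NNPP; intro E; apply N; exists n; exact E.
Qed.

Lemma dual_system_spec (k : nat) :
  (l2 v (dual_system k) /\ Hop G v (dual_system k) (L k) = RtoC 1 /\
   (forall j, j <> k -> Hop G v (dual_system k) (L j) = RtoC 0)) /\
  kappa k <> RtoC 0 /\
  Cmod (kappa k) ^ 2 = varpi G v L e k * w k.
Proof.
  pose proof (Hw k) as Wk.
  destruct (Nat.eq_dec k 0) as [->|Hk].
  - assert (E : forall n, e n = dual_system 0 n)
      by (intro n; unfold dual_system; simpl; field; apply LG_neq_0).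
    split; [split; [|split]|split].
    + apply l2_ext with (2 := He), E.
    + rewrite <- He1; apply Hop_ext; intro n; symmetry; apply E.
    + intros j Hj; rewrite <- (He0 j Hj); apply Hop_ext; intro n; symmetry; apply E.
    + simpl; intro Z; injection Z; lra.
    + simpl; rewrite Cmod_1; unfold w in *; field; lra.
  (* Exactness gives a nonzero vector vanishing on the rest of [L]; uniqueness prevents it from
     vanishing at [L k], so it can be normalised to a vector a dual to [L k]. *)
  - destruct (Hexact k) as (a0 & Ha0 & [n0 Hn0] & Hz0).
    set (al := Hop G v a0 (L k)).
    assert (Hal : al <> RtoC 0).
    { intro Z; apply Hn0, (proj2 (proj2 Huniq) a0 Ha0).
      intro j; destruct (Nat.eq_dec j k) as [->|Hj]; [exact Z | apply Hz0, Hj]. }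
    set (a := fun n => (/ al * a0 n)%C).
    assert (Ha : l2 v a) by (apply l2_scal; auto).
    assert (Ha1 : Hop G v a (L k) = RtoC 1)
      by (unfold a; rewrite Hop_scal by auto; fold al; apply Cinv_l, Hal).
    assert (Haz : forall j, j <> k -> Hop G v a (L j) = RtoC 0)
      by (intros j Hj; unfold a; rewrite Hop_scal, Hz0 by auto; ring).
    assert (Hok : 0%nat <> k) by auto.
    pose proof (dual_system_proportional G v Hv HG L 0 k e a Huniq Hok He Ha
                  He1 He0 Ha1 Haz) as HP.
    destruct (Hop_nonzero e (L 0%nat)) as [m Hm];
      [rewrite He1; intro Z; injection Z; lra|].
    (* The proportionality relation with m fixed at a nonzero coordinate of e determines every
       a_n. *)
    set (c := (a m * (L k - G m) * / (e m * (L 0%nat - G m)))%C).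
    assert (Ea : forall n, a n = (c * (e n * (L 0%nat - G n) * / (L k - G n)))%C).
    { intro n; unfold c.
      pose proof (LG_neq_0 k n); pose proof (LG_neq_0 0 m).
      transitivity ((a n * e m * (L k - G n) * (L 0%nat - G m))
        * / (e m * (L 0%nat - G m) * (L k - G n)))%C; [field; auto|].
      rewrite <- HP; field; auto. }
    assert (Hc : c <> RtoC 0).
    { intro Z; destruct (Hop_nonzero a (L k)) as [p Hp];
        [rewrite Ha1; intro Z1; injection Z1; lra|].
      apply Hp; rewrite Ea, Z; ring. }
    assert (D0 : (L 0%nat - L k)%C <> RtoC 0)
      by (apply Cminus_neq_0; intro Z; apply Hok, HLinj, Z).
    set (D := CSeries (fun n => e n * RtoC (v n) * / ((L k - G n) * (L k - G n)))%C).
    (* Partial fractions express D through the transforms of a and e at [L k], which are 1 and 0. *)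
    assert (HD : D = (/ (c * (L 0%nat - L k)))%C).
    { unfold D.
      rewrite (CSeries_ext _ (fun n => / (c * (L 0%nat - L k)) * (a n * RtoC (v n) * / (L k - G n))
        - / (L 0%nat - L k) * (e n * RtoC (v n) * / (L k - G n)))%C).
      - rewrite CSeries_minus, !CSeries_scal by (auto using summable_scal, Hop_summable).
        change (CSeries (fun n => a n * RtoC (v n) * / (L k - G n))%C) with (Hop G v a (L k)).
        change (CSeries (fun n => e n * RtoC (v n) * / (L k - G n))%C) with (Hop G v e (L k)).
        rewrite Ha1, He0 by exact Hk; ring.
      - intro n; rewrite (Ea n); pose proof (LG_neq_0 k n); field; auto. }
    assert (Ek : kappa k = c).
    { unfold kappa; destruct k as [|k]; [contradiction|].
      fold D; rewrite HD; field; auto. }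
    assert (E : forall n, a n = dual_system k n)
      by (intro n; unfold dual_system; rewrite Ek; apply Ea).
    split; [split; [|split]|split].
    + apply l2_ext with (2 := Ha), E.
    + rewrite <- Ha1; apply Hop_ext; intro n; symmetry; apply E.
    + intros j Hj; rewrite <- (Haz j Hj); apply Hop_ext; intro n; symmetry; apply E.
    + rewrite Ek; exact Hc.
    + assert (HD0 : D <> RtoC 0).
      { rewrite HD; intro Z; apply Hc.
        replace c with (c * (/ (c * (L 0%nat - L k)) * (c * (L 0%nat - L k))))%C
          by (field; auto); rewrite Z; ring. }
      destruct k as [|k]; [contradiction|].
      simpl kappa; fold D; unfold varpi; fold D.
      rewrite Cmod_inv by (apply Cmult_neq_0; assumption).
      rewrite Cmod_mult, (Cmod_minus_sym (L (S k)) (L 0%nat)).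
      apply Cmod_gt_0 in HD0; apply Cmod_gt_0 in D0.
      unfold w in *; field; repeat split; lra.
Qed.

Lemma varpi_pos (k : nat) : 0 < varpi G v L e k.
Proof.
  destruct (dual_system_spec k) as (_ & A & B).
  apply Cmod_gt_0 in A; pose proof (Hw k) as Wk.
  assert (0 < varpi G v L e k * w k) by (rewrite <- B; apply pow_lt, A).
  apply Rmult_lt_reg_r with (1 := Wk); lra.
Qed.

(** Biorthogonality of the dual system with evaluation on [L]. *)
Lemma Hop_comb (N : nat) (b : nat -> C) (j : nat) :
  Hop G v (comb dual_system N b) (L j) = trunc (RtoC 0) N b j.
Proof.
  assert (Hd : forall k, l2 v (dual_system k)) by (intro k; apply dual_system_spec).
  unfold comb; rewrite (Hop_cpsum G v Hv (fun k n => b k * dual_system k n)%C)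
    by (auto; intro; apply l2_scal; auto).
  induction N as [|N IH]; simpl; [reflexivity|].
  rewrite IH, Hop_scal by auto; unfold trunc.
  destruct (dual_system_spec N) as ((_ & A & B) & _).
  destruct (Nat.lt_trichotomy j N) as [H|[->|H]].
  - rewrite B by lia.
    replace (Nat.ltb j N) with true by (symmetry; apply Nat.ltb_lt; lia).
    replace (Nat.ltb j (S N)) with true by (symmetry; apply Nat.ltb_lt; lia); ring.
  - rewrite A, Nat.ltb_irrefl.
    replace (Nat.ltb N (S N)) with true by (symmetry; apply Nat.ltb_lt; lia); ring.
  - rewrite B by lia.
    replace (Nat.ltb j N) with false by (symmetry; apply Nat.ltb_ge; lia).
    replace (Nat.ltb j (S N)) with false by (symmetry; apply Nat.ltb_ge; lia); ring.
Qed.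

Lemma nu_pos (n : nat) : 0 <= nu G v L e n.
Proof.
  unfold nu; apply Rmult_le_pos; [|apply pow2_Cmod_pos].
  apply Rmult_le_pos; [apply Hv0 | apply pow2_Cmod_pos].
Qed.

(* [kappa j] converts coefficients of the dual system, weighted by [w],
   into arguments of the transform from [L] to [G], weighted by [varpi]. *)
Definition to_coef (b : nat -> C) (j : nat) : C :=
  (b j * RtoC (varpi G v L e j) * / kappa j)%C.

Lemma to_coef_sq (b : nat -> C) (j : nat) :
  Cmod (to_coef b j) ^ 2 * w j = Cmod (b j) ^ 2 * varpi G v L e j.
Proof.
  destruct (dual_system_spec j) as (_ & A & B); pose proof (varpi_pos j) as V.
  unfold to_coef; rewrite !Cmod_mult, Cmod_R, Cmod_inv, Rabs_right by (assumption || lra).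
  apply Cmod_gt_0 in A; set (q := Cmod (kappa j)) in *.
  replace (w j) with (q ^ 2 * / varpi G v L e j) by (rewrite B; field; lra).
  field; lra.
Qed.

(** [kappa j] cancels, leaving a Cauchy term times a factor depending on n alone; the squared
    modulus of that factor, weighted by [v n], is [nu]. The sign comes from reversing L j - G n. *)
Lemma to_coef_term (b : nat -> C) (j n : nat) :
  (to_coef b j * dual_system j n
   = - (e n * (L 0%nat - G n)) * (b j * RtoC (varpi G v L e j) * / (G n - L j)))%C.
Proof.
  destruct (dual_system_spec j) as (_ & A & _); pose proof (LG_neq_0 j n) as D.
  assert (D' : (G n - L j)%C <> RtoC 0).
  { intro Z; apply D; replace (L j - G n)%C with (- (G n - L j))%C by ring.
    rewrite Z; ring. }
  unfold to_coef, dual_system; field; auto.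
Qed.

Lemma nu_term (n : nat) (z : C) :
  Cmod (- (e n * (L 0%nat - G n)) * z)%C ^ 2 * v n = Cmod z ^ 2 * nu G v L e n.
Proof. rewrite Cmod_mult, Cmod_opp, Cmod_mult; unfold nu; ring. Qed.

End Dual.

(** * Consequences of invertibility *)

Lemma invertible_lower_bound :
  invertible_map v w (Hseq G v L) ->
  exists M, forall a, l2 v a -> nsq v a <= M ^ 2 * nsq w (Hseq G v L a).
Proof.
  intros (HT & Inv & HS & HST & _ & M & HM); exists M; intros a Ha.
  rewrite <- (nsq_ext v _ _ (HST a Ha)).
  apply l2norm_le_nsq; auto.
Qed.

Lemma invertible_exact :
  invertible_map v w (Hseq G v L) -> exact_uniqueness_seq G v L.
Proof.
  intro Hinv; destruct (invertible_lower_bound Hinv) as [M HM].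
  destruct Hinv as (HT & Inv & HS & _ & HTS & _).
  split; [split; [exact HLinj | split; [exact HL|]]|].
  - intros a Ha Hz n.
    assert (E : nsq w (Hseq G v L a) = 0).
    { rewrite (nsq_ext w _ (trunc (RtoC 0) 0 a)) by exact Hz.
      apply nsq_trunc. }
    pose proof (HM a Ha) as B; rewrite E, Rmult_0_r in B.
    pose proof (term_le_nsq v Hv0 a n Ha); pose proof (Hv n).
    pose proof (pow2_Cmod_pos (a n)).
    assert (Z : Cmod (a n) ^ 2 = 0) by nra.
    apply Cmod_eq_0; nra.
  - intro k.
    (* The k-th unit vector, cut just after k so that square-summability is immediate; its preimage
       is dual to [L k]. *)
    set (b := trunc (RtoC 0) (S k) (fun j => if Nat.eqb j k then RtoC 1 else RtoC 0)).
    assert (Hb : l2 w b) by apply l2_trunc.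
    exists (Inv b); split; [apply HS, Hb | split].
    + apply (Hop_nonzero (Inv b) (L k)).
      change (Hop G v (Inv b) (L k)) with (Hseq G v L (Inv b) k); rewrite HTS by exact Hb.
      unfold b, trunc; rewrite Nat.eqb_refl.
      replace (Nat.ltb k (S k)) with true by (symmetry; apply Nat.ltb_lt; lia).
      intro Z; injection Z; lra.
    + intros j Hj; change (Hop G v (Inv b) (L j)) with (Hseq G v L (Inv b) j).
      rewrite HTS by exact Hb; unfold b, trunc.
      apply Nat.eqb_neq in Hj; rewrite Hj; destruct (Nat.ltb j _); reflexivity.
Qed.

Lemma invertible_generating_vector :
  invertible_map v w (Hseq G v L) ->
  exists e, l2 v e /\ Hop G v e (L 0%nat) = RtoC 1 /\
    (forall j, j <> 0%nat -> Hop G v e (L j) = RtoC 0).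
Proof.
  intros (_ & Inv & HS & _ & HTS & _).
  set (b := trunc (RtoC 0) 1 (fun _ => RtoC 1)).
  assert (Hb : l2 w b) by apply l2_trunc.
  exists (Inv b); split; [apply HS, Hb | split].
  - apply (HTS b Hb 0%nat).
  - intros [|j] Hj; [contradiction|]; apply (HTS b Hb (S j)).
Qed.

Section Equivalence.
Variable e : nat -> C.
Hypothesis Hex : exact_uniqueness_seq G v L.
Hypothesis He : l2 v e.
Hypothesis He1 : Hop G v e (L 0%nat) = RtoC 1.
Hypothesis He0 : forall j, j <> 0%nat -> Hop G v e (L j) = RtoC 0.

Let x := dual_system e.
Let vp := varpi G v L e.
Let spec := dual_system_spec e (proj1 Hex) (proj2 Hex) He He1 He0.
Let Hx (j : nat) : l2 v (x j) := proj1 (proj1 (spec j)).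
Let vp_pos : forall j, 0 < vp j := varpi_pos e (proj1 Hex) (proj2 Hex) He He1 He0.
Let vp0 (j : nat) : 0 <= vp j := Rlt_le _ _ (vp_pos j).

(** * Invertibility implies boundedness of the transform from [L] to [G] *)

Section Forward.
Variable M : R.
Hypothesis HT : forall a, l2 v a -> l2 w (Hseq G v L a).
Hypothesis HM : forall a, l2 v a -> nsq v a <= M ^ 2 * nsq w (Hseq G v L a).

(** The lower bound for the transform, applied to a combination whose transform is the truncated
    b. *)
Lemma comb_bound (N : nat) (b : nat -> C) :
  nsq v (comb x N b) <= M ^ 2 * psum (fun j => Cmod (b j) ^ 2 * w j) N.
Proof.
  apply Rle_trans with (1 := HM _ (comb_l2 v x Hv Hx N b)).
  rewrite <- (nsq_trunc w b N).
  rewrite (nsq_ext w _ (trunc (RtoC 0) N b)); [apply Rle_refl|].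
  intro j; apply Hop_comb; auto; apply Hex.
Qed.

(* If [e n = 0] then no dual vector has an n-th coordinate, although the finite
   combinations of the dual system are dense. *)
Lemma generating_vector_nonzero (n : nat) : e n <> RtoC 0.
Proof.
  intro Z.
  set (d := fun k : nat => if Nat.eqb k n then RtoC 1 else RtoC 0).
  assert (Hd : l2 v d).
  { apply l2_ext with (trunc (RtoC 0) (S n) d); [|apply l2_trunc].
    intro k; unfold trunc, d; destruct (Nat.ltb k (S n)) eqn:E; [reflexivity|].
    apply Nat.ltb_ge in E; replace (Nat.eqb k n) with false; [reflexivity|].
    symmetry; apply Nat.eqb_neq; lia. }
  set (b := Hseq G v L d); assert (Hb : l2 w b) by (apply HT, Hd).
  (* With b the transform of the unit vector d, the transform of d minus the N-th combination is a
     tail of b. The n-th coordinate of that difference stays 1, so its squared norm is at least v_n,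
     while the tail tends to 0. *)
  assert (B : forall N, v n <= M ^ 2 * (nsq w b - psum (fun j => Cmod (b j) ^ 2 * w j) N)).
  { intro N; pose proof (comb_l2 v x Hv Hx N b) as Hc.
    pose proof (l2_minus v Hv0 _ _ Hd Hc) as Hdc.
    rewrite <- nsq_tail by assumption.
    rewrite <- (nsq_ext w (Hseq G v L (fun n => d n - comb x N b n)%C)).
    - apply Rle_trans with (2 := HM _ Hdc).
      apply Rle_trans with (2 := term_le_nsq v Hv0 _ n Hdc).
      assert (E : comb x N b n = RtoC 0).
      { unfold comb, x, dual_system; rewrite Z; clear.
        induction N as [|N IH]; simpl; [reflexivity|]; rewrite IH; ring. }
      rewrite E; unfold d; rewrite Nat.eqb_refl.
      replace (RtoC 1 - RtoC 0)%C with (RtoC 1) by ring; rewrite Cmod_1; lra.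
    - intro j; unfold Hseq; rewrite Hop_minus by auto.
      f_equal; f_equal; apply Hop_comb; auto; apply Hex. }
  pose proof (Hv n).
  assert (v n <= 0); [|lra].
  apply (is_lim_seq_le (fun _ => v n)
    (fun N => M ^ 2 * (nsq w b - psum (fun j => Cmod (b j) ^ 2 * w j) N)) (v n) 0 B).
  - apply is_lim_seq_const.
  - replace (Finite 0) with (Rbar_mult (M ^ 2) 0) by (simpl; f_equal; ring).
    apply is_lim_seq_scal_l, psum_tail_lim, Hb.
Qed.

(** Since |kappa_j|^2 / w_j = varpi_j, the series is that of [coefficient_bound] divided by |e_n|^2
    |L 0 - G n|^2, a division made possible by e_n being nonzero. *)
Lemma forward_dual (n : nat) : dual L vp (G n).
Proof.
  split.
  - intros j E; apply (proj1 (HL j) n); symmetry; exact E.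
  - pose proof (coefficient_bound v w x (M ^ 2) Hv Hw Hx comb_bound n) as B.
    apply (ex_series_scal_R (/ (Cmod (e n) ^ 2 * Cmod (L 0%nat - G n)%C ^ 2))) in B.
    refine (ex_series_ext_R _ _ _ B); intro j.
    destruct (spec j) as (_ & A & E).
    pose proof (generating_vector_nonzero n) as Hn.
    pose proof (LG_neq_0 j n) as Dj; pose proof (LG_neq_0 0 n) as D0.
    unfold x, dual_system; rewrite !Cmod_mult, Cmod_inv by exact Dj.
    rewrite (Cmod_minus_sym (G n)).
    apply Cmod_gt_0 in Hn; apply Cmod_gt_0 in Dj; apply Cmod_gt_0 in D0.
    pose proof (Hw j) as Wj.
    replace (vp j) with (Cmod (kappa e j) ^ 2 * / w j)
      by (rewrite E; unfold vp; field; lra).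
    field; repeat split; lra.
Qed.

Lemma forward_bounded : bounded_map vp (nu G v L e) (Hseq L vp G).
Proof.
  assert (HK0 : 0 <= M ^ 2) by apply pow2_ge_0.
  (* This is |M|; the sign of [M] is not known. *)
  exists (sqrt (M ^ 2)); intros b Hb.
  set (c := to_coef e b).
  assert (Hsq : forall j, Cmod (b j) ^ 2 * vp j = Cmod (c j) ^ 2 * w j)
    by (intro j; symmetry; apply to_coef_sq; auto; apply Hex).
  assert (Hc : l2 w c) by exact (ex_series_ext_R _ _ Hsq Hb).
  destruct (synth_bound v w x (M ^ 2) Hv Hw Hx comb_bound HK0 c Hc) as [A B].
  assert (E : forall n, Cmod (synth x c n) ^ 2 * v n
                        = Cmod (Hseq L vp G b n) ^ 2 * nu G v L e n).
  { intro n; rewrite <- nu_term; f_equal; f_equal; f_equal.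
    unfold synth, Hseq, Hop; rewrite <- CSeries_scal
      by (apply Hop_summable; auto using forward_dual).
    apply CSeries_ext; intro j; apply to_coef_term; auto; apply Hex. }
  split; [exact (ex_series_ext_R _ _ E A)|].
  apply l2norm_le_sqrt; auto.
  unfold nsq; rewrite <- (Series_ext _ _ E), (Series_ext _ _ Hsq); exact B.
Qed.

End Forward.

(** * Boundedness of the transform from [L] to [G] implies invertibility *)

Section Backward.
Variables M M' : R.
Hypothesis HT : forall a, l2 v a -> l2 w (Hseq G v L a) /\
  nsq w (Hseq G v L a) <= M ^ 2 * nsq v a.
Hypothesis HT' : forall b, l2 vp b -> l2 (nu G v L e) (Hseq L vp G b) /\
  nsq (nu G v L e) (Hseq L vp G b) <= M' ^ 2 * nsq vp b.

Lemma backward_comb_bound (N : nat) (c : nat -> C) :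
  nsq v (comb x N c) <= M' ^ 2 * psum (fun j => Cmod (c j) ^ 2 * w j) N.
Proof.
  (* The preimage of c under [to_coef]; truncating it makes the transform from [L] to [G] a finite
     sum, to which the hypothesis applies. *)
  set (b := fun j => (c j * kappa e j * / RtoC (vp j))%C).
  assert (Hcb : forall j, c j = to_coef e b j).
  { intro j; destruct (spec j) as (_ & A & _); unfold to_coef, b; fold vp.
    assert (RtoC (vp j) <> RtoC 0)
      by (intro Z; injection Z; intro Z'; pose proof (vp_pos j); lra).
    field; auto. }
  pose proof (l2_trunc vp b N) as Hb; destruct (HT' _ Hb) as [_ B].
  rewrite nsq_trunc in B.
  rewrite (psum_ext _ (fun j => Cmod (c j) ^ 2 * w j)) in B
    by (intros j _; rewrite Hcb; symmetry; apply to_coef_sq; auto; apply Hex).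
  apply Rle_trans with (2 := B); right; apply Series_ext; intro n.
  rewrite <- nu_term; f_equal; f_equal; f_equal.
  transitivity (- (e n * (L 0%nat - G n)) *
    CSeries (trunc (RtoC 0) N (fun j => b j * RtoC (vp j) * / (G n - L j))))%C.
  - rewrite CSeries_trunc, <- cpsum_scal; unfold comb; apply cpsum_ext; intros j _.
    rewrite Hcb; apply to_coef_term; auto; apply Hex.
  - f_equal; apply CSeries_ext; intro j; unfold trunc; destruct (Nat.ltb j N); ring.
Qed.

Lemma backward_invertible : invertible_map v w (Hseq G v L).
Proof.
  split; [intros a Ha; apply HT, Ha|].
  assert (HK0 : 0 <= M' ^ 2) by apply pow2_ge_0.
  pose proof (synth_bound v w x (M' ^ 2) Hv Hw Hx backward_comb_bound HK0) as SB.
  assert (TS : forall c, l2 w c -> forall j, Hseq G v L (synth x c) j = c j).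
  { intros c Hc j.
    destruct (SB c Hc) as [Hs _].
    assert (Z : Cmod (Hop G v (synth x c) (L j) - c j)%C ^ 2 * w j <= 0).
    (* Every cut exceeds j, thanks to the offset S j, so the transform of the finite combination is
       already c_j at [L j]. The error is then the j-th coordinate of the transform of the tail,
       controlled by both operator bounds. *)
    { apply (is_lim_seq_le (fun _ => Cmod (Hop G v (synth x c) (L j) - c j)%C ^ 2 * w j)
        (fun N => M ^ 2 * (M' ^ 2 * (nsq w c
          - psum (fun j => Cmod (c j) ^ 2 * w j) (N + S j))))
        (Cmod (Hop G v (synth x c) (L j) - c j)%C ^ 2 * w j) 0).
      - intro N.
        destruct (synth_tail v w x (M' ^ 2) Hv Hw Hx backward_comb_bound HK0 c
                    (N + S j) Hc) as [A B].
        destruct (HT _ A) as [A' B'].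
        apply Rle_trans with (M ^ 2 * nsq v (fun n => synth x c n - comb x (N + S j) c n)%C);
          [|apply Rmult_le_compat_l; [apply pow2_ge_0 | exact B]].
        apply Rle_trans with (2 := B'), Rle_trans with (2 := term_le_nsq w Hw0 _ j A').
        unfold Hseq; rewrite Hop_minus by (auto using comb_l2).
        unfold x at 3; rewrite Hop_comb by (auto; apply Hex).
        unfold trunc; replace (Nat.ltb j (N + S j)) with true
          by (symmetry; apply Nat.ltb_lt; lia).
        apply Rle_refl.
      - apply is_lim_seq_const.
      - replace (Finite 0) with (Rbar_mult (M ^ 2) (Rbar_mult (M' ^ 2) 0))
          by (simpl; f_equal; ring).
        do 2 apply is_lim_seq_scal_l.
        apply (is_lim_seq_incr_n (fun N => nsq w c - psum (fun j => Cmod (c j) ^ 2 * w j) N)).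
        apply psum_tail_lim, Hc. }
    pose proof (Hw j); pose proof (pow2_Cmod_pos (Hop G v (synth x c) (L j) - c j)%C).
    assert (Z' : Cmod (Hop G v (synth x c) (L j) - c j)%C ^ 2 = 0) by nra.
    assert (Z2 : (Hop G v (synth x c) (L j) - c j)%C = RtoC 0) by (apply Cmod_eq_0; nra).
    unfold Hseq; replace (c j) with (RtoC 0 + c j)%C by ring; rewrite <- Z2; ring. }
  exists (synth x); split; [|split; [|split]].
  - intros c Hc; apply SB, Hc.
  - intros a Ha n; destruct (HT a Ha) as [Hc _]; destruct (SB _ Hc) as [Hs _].
    assert (Z : (synth x (Hseq G v L a) n - a n)%C = RtoC 0).
    (* The left inverse follows from the right one by uniqueness: both vectors have the same
       transform on [L]. *)
    { apply (proj2 (proj2 (proj1 Hex)) _ (l2_minus v Hv0 _ _ Hs Ha)); intro j.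
      rewrite Hop_minus by auto.
      change (Hop G v (synth x (Hseq G v L a)) (L j))
        with (Hseq G v L (synth x (Hseq G v L a)) j).
      rewrite TS by exact Hc; unfold Hseq; ring. }
    replace (a n) with (RtoC 0 + a n)%C by ring; rewrite <- Z; ring.
  - exact TS.
  - exists (sqrt (M' ^ 2)); intros c Hc; apply l2norm_le_sqrt; auto.
    apply SB, Hc.
Qed.

End Backward.
End Equivalence.
End Main.

Theorem theorem3 (G : nat -> C) (v : nat -> R) (L : nat -> C) :
  (forall n m, G n = G m -> n = m) ->
  (forall n, 0 < v n) ->
  (exists z, dual G v z) ->
  (forall L' : nat -> C, exact_uniqueness_seq G v L' ->
      exists F : C -> C, generating_function G v L' F) ->
  (forall j k, L j = L k -> j = k) ->
  (forall j, dual G v (L j)) ->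
  bounded_map v (bessel_weight G v L) (Hseq G v L) ->
  (invertible_map v (bessel_weight G v L) (Hseq G v L) <->
   (exact_uniqueness_seq G v L /\
    exists e : nat -> C,
      l2 v e /\
      Hop G v e (L 0%nat) = RtoC 1 /\
      (forall j, j <> 0%nat -> Hop G v e (L j) = RtoC 0) /\
      (forall n, dual L (varpi G v L e) (G n)) /\
      bounded_map (varpi G v L e) (nu G v L e) (Hseq L (varpi G v L e) G))).
Proof.
  intros HG Hv _ _ HLinj HL [M HM].
  assert (Hv0 : forall n, 0 <= v n) by (intro; apply Rlt_le, Hv).
  assert (Hw0 : forall j, 0 <= bessel_weight G v L j)
    by (intro; apply Rlt_le, bessel_weight_pos; assumption).
  split.
  - intro Hinv.
    pose proof (invertible_exact G v L Hv HLinj HL Hinv) as Hex; split; [exact Hex|].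
    destruct (invertible_generating_vector G v L Hinv) as (e & He & He1 & He0).
    destruct (invertible_lower_bound G v L Hv HL Hinv) as [K HK].
    destruct Hinv as [HT _].
    refine (ex_intro _ e (conj He (conj He1 (conj He0 (conj _ _))))).
    + apply (forward_dual G v L HG Hv HLinj HL e Hex He He1 He0 K HT HK).
    + apply (forward_bounded G v L HG Hv HLinj HL e Hex He He1 He0 K HT HK).
  - intros [Hex (e & He & He1 & He0 & _ & M' & HM')].
    pose proof (varpi_pos G v L HG Hv HLinj HL e (proj1 Hex) (proj2 Hex) He He1 He0) as Hvp.
    apply (backward_invertible G v L HG Hv HLinj HL e Hex He He1 He0 M M').
    + intros a Ha; destruct (HM a Ha) as [A B]; split; [exact A|].
      apply l2norm_le_nsq; auto.
    + intros b Hb; destruct (HM' b Hb) as [A B]; split; [exact A|].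
      apply l2norm_le_nsq; auto; [intro; apply Rlt_le, Hvp | apply nu_pos, Hv].
Qed.
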